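(* Let $T$ be an unlabeled circle tree and let $T_3$ be its reduced form (the result of the e-reduction process applied to $T$). Then the genus of $T_3$ is one if and only if the genus of $T$ is one.
   Context: Circle graphs. An unlabeled circle graph (u-c-graph) is a graph without loops or multiple edges whose vertices lie on a circle, with edges drawn as straight segments; a u-c-tree is a u-c-graph that is a tree. Two edges cross if they share a point other than an endpoint of both; an edge is uncrossed if no edge crosses it, otherwise crossed. Two edges of $G$ are parallel if they cross exactly the same edges of $G$. Genus. For a circle graph with $m\ge1$ edges, split each vertex $v$ of degree $d$ into $d$ nearby points on the circle, one for each edge at $v$, so that edges sharing $v$ do not cross. This gives $N=2m$ points numbered $1,\dots,N$ counterclockwise and a fixed-point-free involution $\alpha$ exchanging the endpoints of each edge. With $\sigma=(1\,2\cdots N)$ and $z$ the number of cycles, the genus is $1+\frac12(N-1-z(\alpha)-z(\alpha^{-1}\sigma))$. A graph without edges has genus $0$. E-graphs. Arc $\widehat{XY}$ is the closed arc from $X$ to $Y$ counterclockwise. Let $AB$ be a crossed edge of $G$. Consider all edges $a_1,\dots,a_l$ of $G$ parallel to $AB$ (including $AB$) which can be joined to $AB$ by a path of edges starting with $AB$ and ending with the given edge, each edge of the path being uncrossed or parallel to $AB$; order them so that $a_i,a_j$ are the outermost among $a_i,\dots,a_j$ for all $i\le j$. Write $a_1=CD$, $a_l=EF$ with $C,D,E,F$ in counterclockwise order (if $l=1$ then $D=E$, $C=F$). The e-graph containing $AB$ consists of all edges of $G$ that have both endpoints in $\widehat{DE}\cup\widehat{FC}$ and are uncrossed or parallel to $AB$.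 $\widehat{DE},\widehat{FC}$ are its arcs; its crossed edges are its parallel edges. A path $E_1E_2,\dots,E_kE_{k+1}$ connects e-graphs $\mathcal E_1,\mathcal E_2$ if $E_1$ is its only vertex in one of them, $E_{k+1}$ is its only vertex in the other, and it has no vertex in any further e-graph. E-reduction of a u-c-tree $T$. Step 1: for every e-graph of $T$ delete all but one of its parallel edges. Step 2: delete all uncrossed edges and discard vertices of degree zero; the result is $T_2$. Step 3: for every path of uncrossed edges of $T$ connecting two e-graphs $\mathcal E_1$ (arcs $\mathcal A_1,\mathcal A_2$; remaining edge $A_1A_2$, $A_i\in\mathcal A_i$) and $\mathcal E_2$ (arcs $\mathcal B_1,\mathcal B_2$; remaining edge $B_1B_2$, $B_i\in\mathcal B_i$), with one end of the path in $\mathcal A_j$ and the other in $\mathcal B_i$, add the edge $A_jB_i$ to $T_2$ (if $A_j\neq B_i$ and it is not already present). The result $T_3$ is the reduced form of $T$. *)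

(* Defs.v *)
From mathcomp Require Import all_boot all_order all_fingroup all_algebra.

Set Implicit Arguments.
Unset Strict Implicit.
Unset Printing Implicit Defensive.

Import GRing.Theory.

(* The circle carries n positions, numbered counterclockwise by 'I_n.  An
   unlabeled circle graph only depends on the cyclic order of its vertices, so
   it is given by the positions its vertices occupy and by its edges, which are
   two-element sets of vertices. *)
Record cgraph (n : nat) := CGraph {
  verts : {set 'I_n};
  edges : {set {set 'I_n}};
  edgesP : forall e, e \in edges -> e \subset verts /\ #|e| = 2 }.

Section Circle.
Variable n : nat.
Implicit Types (x y : 'I_n) (e f g : {set 'I_n}) (G : cgraph n).

Definition adj G : rel 'I_n := [rel x y | [set x; y] \in edges G].

Definition is_tree G : Prop :=
  [/\ verts G != set0,
      {in verts G &, forall x y, connect (adj G) x y} &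
      forall c : seq 'I_n, 2 < size c -> ~ ucycle (adj G) c].

(* Number of counterclockwise steps from x to y. *)
Definition ccw x y : nat := (y + n - x) %% n.

Definition arc x y : {set 'I_n} := [set p | ccw x p <= ccw x y].

(* The chords ab and cd share a point which is not an endpoint of both exactly
   when a, c, b, d are distinct and in this cyclic order. *)
Definition crosses e f : bool :=
  [exists a, exists b, exists c, exists d,
    [&& e == [set a; b], f == [set c; d], 0 < ccw a c < ccw a b &
        ccw a b < ccw a d]].

Definition crossed G e : bool := [exists f in edges G, crosses e f].

Definition parallel G e f : bool :=
  [&& e \in edges G, f \in edges G &
      [forall g in edges G, crosses e g == crosses f g]].

(* The edges E_1E_2, ..., E_kE_(k+1) of the vertex sequence
   x :: p = E_1, ..., E_(k+1). *)
Definition path_edges x (p : seq 'I_n) : seq {set 'I_n} :=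
  pairmap (fun u v => [set u; v]) x p.

Definition is_path G x (p : seq 'I_n) : bool :=
  [&& 0 < size p, uniq (x :: p) & path (adj G) x p].

(* The points obtained by splitting the vertices; (v, w) is the point which
   replaces v on the edge vw.  They are listed counterclockwise.  Two edges at
   v do not cross after splitting when the first of their two points at v
   belongs to the edge whose other end is farther from v counterclockwise, so
   the neighbours of v are met in the order v - 1, v - 2, ..., v + 1. *)
Definition points G : seq ('I_n * 'I_n) :=
  [seq (v, w) | v <- enum 'I_n, w <- [seq w <- rev (rot v.+1 (enum 'I_n)) | adj G v w]].

Definition swap (d : 'I_n * 'I_n) := (d.2, d.1).

Lemma mem_points G d : (d \in points G) = adj G d.1 d.2.
Proof.
case: d => v w; apply/allpairsPdep/idP => /= [[v' [w' [_]]]|vw].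
  by rewrite mem_filter => /andP[vw _] [-> ->].
by exists v, w; rewrite mem_enum mem_filter vw mem_rev mem_rot mem_enum.
Qed.

Lemma points_uniq G : uniq (points G).
Proof.
apply: allpairs_uniq_dep; first exact: enum_uniq.
  by move=> v _; rewrite filter_uniq // rev_uniq rot_uniq enum_uniq.
by move=> [v w] [v' w'] _ _ /= [-> ->].
Qed.

Lemma swap_points G d : (swap d \in points G) = (d \in points G).
Proof. by rewrite !mem_points /adj /= setUC. Qed.

Definition npoints G : nat := size (points G).

Lemma alpha_subproof G (i : 'I_(npoints G)) :
  index (swap (tnth (in_tuple (points G)) i)) (points G) < npoints G.
Proof. by rewrite index_mem swap_points mem_tnth. Qed.

Definition alpha_fun G (i : 'I_(npoints G)) : 'I_(npoints G) :=
  Ordinal (alpha_subproof i).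

Lemma alpha_funK G : involutive (@alpha_fun G).
Proof.
move=> i; apply: val_inj; rewrite /=.
rewrite (tnth_nth (tnth (in_tuple (points G)) i)) /= nth_index; last first.
  by rewrite swap_points mem_tnth.
rewrite /swap /= -surjective_pairing.
rewrite (tnth_nth (tnth (in_tuple (points G)) i)) /=.
by rewrite index_uniq ?points_uniq ?ltn_ord.
Qed.

Definition alpha G : {perm 'I_(npoints G)} := perm (inv_inj (@alpha_funK G)).

Definition sigma G : {perm 'I_(npoints G)} := perm (@ordS_inj (npoints G)).

Definition ncycles (T : finType) (s : {perm T}) : nat := #|porbits s|.

Definition genus G : rat :=
  if edges G == set0 then 0%R
  else (1 + ((npoints G)%:R - 1 - (ncycles (alpha G))%:R
             - (ncycles ((alpha G)^-1 * sigma G)%g)%:R) / 2)%R.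

(* For edges CD and EF: C, D, E, F are in counterclockwise order, where D = E
   or F = C is allowed when the edges share a vertex.  When CD and EF are the
   same edge this forces D = E and F = C. *)
Definition ccw4 (C D E F : 'I_n) : bool := ccw D E <= ccw D F <= ccw D C.

(* Among the parallel edges b, c and e, the outermost ones are b and c. *)
Definition between b c e : bool :=
  [exists C, exists D, exists E, exists F,
    [&& b == [set C; D], c == [set E; F], ccw4 C D E F &
        e \subset arc D E :|: arc F C]].

(* e is parallel to b and joined to b by a path as in the definition of the
   e-graph containing b. *)
Definition joined G b e : Prop :=
  parallel G b e /\
  exists x p, [/\ is_path G x p,
    head set0 (path_edges x p) = b, last set0 (path_edges x p) = e &
    {in path_edges x p, forall f, ~~ crossed G f || parallel G b f}].

Definition ordered_parallels G b (s : seq {set 'I_n}) : Prop :=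
  [/\ uniq s, forall e, e \in s <-> joined G b e &
      forall i k j, i <= k <= j -> j < size s ->
        between (nth set0 s i) (nth set0 s j) (nth set0 s k)].

(* H is an e-graph of G, given by its set of edges, with arcs A1 and A2.
   Reversing the sequence s exchanges A1 and A2. *)
Definition is_egraph G (H : {set {set 'I_n}}) (A1 A2 : {set 'I_n}) : Prop :=
  exists b s C D E F,
    [/\ b \in edges G, crossed G b & ordered_parallels G b s] /\
    [/\ head set0 s = [set C; D], last set0 s = [set E; F], ccw4 C D E F,
        A1 = arc D E /\ A2 = arc F C &
        H = [set e in edges G | (e \subset A1 :|: A2) &&
                                (~~ crossed G e || parallel G b e)]].

Definition egraph G H : Prop := exists A1 A2, is_egraph G H A1 A2.

Definition parallel_edges G (H : {set {set 'I_n}}) : {set {set 'I_n}} :=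
  [set e in H | crossed G e].

(* The vertices of an e-graph H form the set cover H. *)
Definition only_vertex_in x (s : seq 'I_n) (H : {set {set 'I_n}}) : Prop :=
  forall v, v \in s /\ v \in cover H <-> v = x.

Definition connects G x (p : seq 'I_n) (H K : {set {set 'I_n}}) : Prop :=
  [/\ is_path G x p, only_vertex_in x (x :: p) H,
      only_vertex_in (last x p) (x :: p) K &
      forall L, egraph G L -> L <> H -> L <> K ->
        {in x :: p, forall v, v \notin cover L}].

Definition step1 (T T1 : cgraph n) : Prop :=
  [/\ verts T1 = verts T,
      edges T1 \subset edges T,
      forall e, e \in edges T -> e \notin edges T1 ->
        exists2 H, egraph T H & e \in parallel_edges T H &
      forall H, egraph T H -> #|parallel_edges T H :&: edges T1| = 1].

Definition step2 (T1 T2 : cgraph n) : Prop :=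
  edges T2 = [set e in edges T1 | crossed T1 e] /\
  verts T2 = [set v in verts T1 | [exists e in edges T2, v \in e]].

(* By the symmetry of is_egraph in its two arcs, the arcs which contain the
   ends of the path may be called A1 and B1. *)
Definition new_edge (T T2 : cgraph n) e : Prop :=
  exists H A1 A2 K B1 B2 x p a1 a2 b1 b2,
    [/\ is_egraph T H A1 A2, is_egraph T K B1 B2 & H <> K] /\
    [/\ [set a1; a2] \in H :&: edges T2, a1 \in A1 & a2 \in A2] /\
    [/\ [set b1; b2] \in K :&: edges T2, b1 \in B1 & b2 \in B2] /\
    [/\ connects T x p H K,
        {in path_edges x p, forall f, ~~ crossed T f},
        x \in A1, last x p \in B1 & a1 <> b1 /\ e = [set a1; b1]].

Definition step3 (T T2 T3 : cgraph n) : Prop :=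
  verts T3 = verts T2 /\
  forall e, e \in edges T3 <-> e \in edges T2 \/ new_edge T T2 e.

(* The reduced form depends on the edges kept in the first step, hence a
   relation. *)
Definition reduced_form (T T3 : cgraph n) : Prop :=
  exists T1 T2, [/\ step1 T T1, step2 T1 T2 & step3 T T2 T3].

End Circle.

(* Main.v *)
(* Writing f for a 2-colouring of the arcs between consecutive points that is
   constant on the cycles of alpha^-1 sigma, the set S of edges at which the
   colour changes is well defined, and the invariance of f says that every edge
   crosses an even number of members of S.  Hence 2^z = 2 |ker M|, where M is
   the crossing matrix over F_2, and the genus is half the rank of M.  So the
   genus is 1 iff the crossed edges fall into two or three parallel classes,
   any two edges of different classes crossing each other.

   This property passes between T and T_2, since every crossed edge is parallel
   to a kept one, and from T_3 to T_2.  If T has it, then distinct e-graphs have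
   disjoint arcs, and an edge added in step 3 crosses nothing: following the
   arcs and the path it replaces, one never changes sides of a kept edge, and
   two added edges could only cross if their paths met, which would join two
   parallel e-graphs, by the bound on the number of classes. *)
Require Import Defs.
From mathcomp Require Import all_boot all_order all_fingroup all_algebra.
From mathcomp Require Import mxabelem zify lra.
Import Defs.

Set Implicit Arguments.
Unset Strict Implicit.
Unset Printing Implicit Defensive.

(** * Crossing chords *)

Section Geometry.
Variable n : nat.
Implicit Types (a b c d p q r x y : 'I_n) (e f g : {set 'I_n}).

(** The bound three on the number of classes counts the nonzero vectors of a plane over F_2: rows of
    the crossing matrix vanish on uncrossed edges and agree exactly on parallel ones. [rank_two]
    states rank 2 without a matrix, so that it can be compared between graphs with different edge
    sets.

    The topology of the disc enters only through [crosses_addb]: for a chord e, crossing e is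
    additive along points off e. Every statement about sides is then a telescoping sum along a walk
    that avoids the ends of e. Most of the work on e-graphs therefore consists in showing that arcs
    and paths avoid the ends of the edge in question; for arcs and crossed edges outside the e-graph
    this uses rank two ([eg_disjoint]). *)

Lemma ccwE x y : ccw x y = if x <= y then y - x else y + n - x.
Proof.
rewrite /ccw; have := ltn_ord x; have := ltn_ord y.
case: (leqP x y) => xy ltyn ltxn.
  by rewrite addnC -addnBA // modnDl modn_small //; lia.
by rewrite modn_small; lia.
Qed.

Lemma set2_eq a b c d :
  [set a; b] = [set c; d] -> (a = c /\ b = d) \/ (a = d /\ b = c).
Proof.
move=> eq2; have := set21 a b; have := set22 a b; rewrite eq2 !inE.
have := set21 c d; have := set22 c d; rewrite -eq2 !inE.
do 4![case/pred2P=> ?]; subst; tauto.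
Qed.

Definition inside a b p := minn a b < p < maxn a b.

(** Cutting the circle at position 0 makes the two sides of a chord the inside and the outside of an
    interval. The resulting parity is symmetric in the ends of each chord and within reach of
    [lia]. *)
Lemma crossesE a b c d :
  crosses [set a; b] [set c; d] =
  [&& c \notin [set a; b], d \notin [set a; b] & inside a b c (+) inside a b d].
Proof.
(* The last conjunct says that c' lies on the counterclockwise arc from a' to b'; it is the only
   part that depends on the orientation of the chords. *)
have key (a' b' c' d' : 'I_n) : (0 < ccw a' c' < ccw a' b') && (ccw a' b' < ccw a' d') =
   [&& c' \notin [set a'; b'], d' \notin [set a'; b'],
       inside a' b' c' (+) inside a' b' d'
     & (a' < c' < b') || (b' < a') && ~~ (b' <= c' <= a')].
  rewrite !inE -!val_eqE /= !ccwE /inside.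
  have := ltn_ord a'; have := ltn_ord b'; have := ltn_ord c'; have := ltn_ord d'.
  do 3![case: ifPn]; lia.
apply/idP/idP.
  case/existsP=> a' /existsP[b' /existsP[c' /existsP[d']]].
  case/and4P=> /eqP/set2_eq ab /eqP/set2_eq cd h1 h2.
  have := key a' b' c' d'; rewrite h1 h2 /= => /esym /and4P[p1 p2 p3 _].
  move: p1 p2 p3; case: ab => -[-> ->]; case: cd => -[-> ->];
    rewrite !inE /inside -!val_eqE /=; lia.
case/and3P=> ca da iab.
suff [a' [b' [c' [d' [ab cd h]]]]] : exists a' b' c' d',
   [/\ [set a; b] = [set a'; b'], [set c; d] = [set c'; d'] &
       (0 < ccw a' c' < ccw a' b') && (ccw a' b' < ccw a' d')].
  apply/existsP; exists a'; apply/existsP; exists b'.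
  apply/existsP; exists c'; apply/existsP; exists d'.
  by rewrite ab cd !eqxx.
(* The ends are renamed so that a' <= b' and c' is the end of the second chord inside this
   interval. *)
have : (a <= b) || (b <= a) by apply: leq_total.
have [ic|ic] := boolP (inside a b c) => lab.
  case/orP: lab => lab; [exists a, b, c, d | exists b, a, c, d]; rewrite ?key.
    split=> //; move: ca da iab ic lab; rewrite !inE /inside -!val_eqE /=; lia.
  split=> //; first by rewrite setUC.
  move: ca da iab ic lab; rewrite !inE /inside -!val_eqE /=; lia.
case/orP: lab => lab; [exists a, b, d, c | exists b, a, d, c]; rewrite ?key.
  split; rewrite 1?[[set c;d]]setUC //.
  move: ca da iab ic lab; rewrite !inE /inside -!val_eqE /=; lia.
split; rewrite 1?setUC // 1?[[set d;c]]setUC //.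
move: ca da iab ic lab; rewrite !inE /inside -!val_eqE /=; lia.
Qed.

Lemma crosses_pair e f : crosses e f ->
  exists a b c d, e = [set a; b] /\ f = [set c; d].
Proof.
case/existsP=> a /existsP[b /existsP[c /existsP[d]]] /and4P[/eqP-> /eqP-> _ _].
by exists a, b, c, d.
Qed.

Lemma crossesC e f : crosses e f = crosses f e.
Proof.
suff imp e' f' : crosses e' f' -> crosses f' e' by apply/idP/idP; apply: imp.
move=> cr; have [a [b [c [d [eqe eqf]]]]] := crosses_pair cr.
move: cr; rewrite {}eqe {}eqf !crossesE !inE /inside -!val_eqE /=; lia.
Qed.

Lemma crosses_disjoint e f : crosses e f -> [disjoint e & f].
Proof.
move=> cr; have [a [b [c [d [eqe eqf]]]]] := crosses_pair cr.
move: cr; rewrite eqe eqf crossesE => /and3P[ca da _].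
rewrite disjoint_sym disjoint_subset; apply/subsetP => z.
by rewrite in_set2 => /pred2P[]->; rewrite inE.
Qed.

Lemma crosses1 e p : crosses e [set p; p] = false.
Proof.
case cr: crosses => //; have [a [b [_ [_ [eqe _]]]]] := crosses_pair cr.
by move: cr; rewrite eqe crossesE addbb !andbF.
Qed.

Lemma crossesxx e : crosses e e = false.
Proof.
case cr: crosses => //; have [a [b [_ [_ [eqe _]]]]] := crosses_pair cr.
move: cr; rewrite {1}eqe => cr.
by move: (disjointFr (crosses_disjoint cr) (set21 a b)); rewrite eqe set21.
Qed.

(** Off its ends a chord has two sides, and crossing it means changing sides. A set e that is not a
    pair crosses nothing. *)
Lemma crosses_addb e p q r : p \notin e -> q \notin e -> r \notin e ->
  crosses e [set p; r] = crosses e [set p; q] (+) crosses e [set q; r].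
Proof.
move=> pe qe re.
have [/existsP[a /existsP[b /eqP eqe]]|none] :=
  boolP [exists a, exists b, e == [set a; b]].
  rewrite eqe in pe qe re *.
  by rewrite !crossesE pe qe re /= -addbA addKb.
have nocr f : crosses e f = false.
  case cr: crosses => //; have [a [b [_ [_ [eqe _]]]]] := crosses_pair cr.
  by case/negP: none; apply/existsP; exists a; apply/existsP; exists b; apply/eqP.
by rewrite !nocr.
Qed.

Lemma mem_arc x y p : (p \in arc x y) = if x <= y then x <= p <= y else (x <= p) || (p <= y).
Proof.
rewrite inE !ccwE; have := ltn_ord p; have := ltn_ord x; have := ltn_ord y.
do 2![case: ifPn]; lia.
Qed.

Lemma arc_not_crossed e x y p q : [disjoint e & arc x y] ->
  p \in arc x y -> q \in arc x y -> crosses e [set p; q] = false.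
Proof.
move=> dis px qx; case cr: crosses => //; have [a [b [_ [_ [eqe _]]]]] := crosses_pair cr.
have := disjointFr dis (_ : a \in e); have := disjointFr dis (_ : b \in e).
rewrite eqe set21 set22 => /(_ isT) bx /(_ isT) ax.
move: cr px qx ax bx; rewrite eqe crossesE !mem_arc !inE /inside -!val_eqE /=.
case: ifPn; lia.
Qed.

(** Going backwards from the common point, the first start of an arc that is reached still lies in
    the other arc. *)
Lemma arc_meet x y x' y' p : p \in arc x y -> p \in arc x' y' ->
  (x \in arc x' y') || (x' \in arc x y).
Proof. rewrite !mem_arc; do 2![case: ifPn]; lia. Qed.

(** The strip between the chords [CD] and [EF], bounded on the circle by the arcs [DE] and [FC]. The
    chords may touch or coincide, but neither may shrink to a point. *)
Definition quad C D E F : Prop := [/\ ccw4 C D E F, C != D & E != F :> 'I_n].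

(** One disjunct for each gap of the cyclic order into which the cut at position 0 may fall. *)
Lemma ccw4E (C D E F : 'I_n) : ccw4 C D E F =
  [|| [&& D <= E, E <= F & F <= C], [&& C < D, D <= E & E <= F],
      [&& F <= C, C < D & D <= E] | [&& E <= F, F <= C & C < D]].
Proof.
rewrite /ccw4 !ccwE.
have := ltn_ord C; have := ltn_ord D; have := ltn_ord E; have := ltn_ord F.
do 3![case: ifPn]; lia.
Qed.

Lemma quad_sym C D E F : quad C D E F -> quad E F C D.
Proof.
case=> h cd ef; split=> //; move: h cd ef; rewrite !ccw4E -!val_eqE /=.
case/or4P=> /and3P[]; lia.
Qed.

Lemma mem_arc_inside c d p : p \notin [set c; d] ->
  (p \in arc d c) = (c < d) (+) inside c d p.
Proof.
rewrite mem_arc !inE /inside -!val_eqE /=.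
by case: ifPn; lia.
Qed.

Lemma crosses_arc a b c d : crosses [set c; d] [set a; b] =
  [&& a \notin [set c; d], b \notin [set c; d] & (a \in arc d c) (+) (b \in arc d c)].
Proof.
rewrite crossesE; have [ca|//] := boolP (a \notin _); have [cb|//] := boolP (b \notin _).
by rewrite !mem_arc_inside // -addbA [_ (+) (_ (+) inside _ _ b)]addbCA addKb.
Qed.

Lemma arc_l x y : x \in arc x y.
Proof. by rewrite mem_arc leqnn /=; case: ifP. Qed.

Lemma arc_r x y : y \in arc x y.
Proof. by rewrite mem_arc leqnn orbT andbT; case: ifP. Qed.

(** The arcs [DC] and [FE] are the inner sides of the two chords. This lemma and the next three show
    that they cover the circle and meet exactly in the two arcs of the strip. *)
Lemma quad_sub1 C D E F p : quad C D E F -> p \in arc D E -> p \in arc D C.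
Proof.
case=> h cd _; move: h cd; rewrite !mem_arc ccw4E -!val_eqE /=.
by case/or4P=> /and3P[h1 h2 h3]; do 2![case: ifPn]; lia.
Qed.

Lemma quad_sub2 C D E F p : quad C D E F -> p \in arc D E -> p \in arc F E.
Proof.
case=> h _ ef; move: h ef; rewrite !mem_arc ccw4E -!val_eqE /=.
by case/or4P=> /and3P[h1 h2 h3]; do 2![case: ifPn]; lia.
Qed.

Lemma quad_cover C D E F p : quad C D E F -> (p \in arc D C) || (p \in arc F E).
Proof.
case=> h cd ef; move: h cd ef; rewrite !mem_arc ccw4E -!val_eqE /=.
by case/or4P=> /and3P[h1 h2 h3]; do 2![case: ifPn]; lia.
Qed.

Lemma quad_meet C D E F p : quad C D E F -> p \in arc D C -> p \in arc F E ->
  p \in arc D E :|: arc F C.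
Proof.
case=> h cd ef; move: h cd ef; rewrite in_setU !mem_arc ccw4E -!val_eqE /=.
by case/or4P=> /and3P[h1 h2 h3]; do 4![case: ifPn]; lia.
Qed.

(** An end of e in the arc [DE] is on the inner side of both chords, so the other end would be on
    the inner side of neither, but the inner sides cover the circle. *)
Lemma cross_quad e C D E F : quad C D E F ->
  crosses e [set C; D] -> crosses e [set E; F] -> [disjoint e & arc D E].
Proof.
move=> q.
have out a b : crosses [set C; D] [set a; b] -> crosses [set E; F] [set a; b] ->
    a \notin arc D E.
  rewrite !crosses_arc => /and3P[_ _ abCD] /and3P[_ _ abEF]; apply/negP=> aDE.
  move: abCD abEF; rewrite (quad_sub1 q aDE) (quad_sub2 q aDE) /= => bCD bEF.
  by have := quad_cover b q; rewrite (negbTE bCD) (negbTE bEF).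
move=> cr; have [a [b [_ [_ [eqe _]]]]] := crosses_pair cr.
move: cr; rewrite eqe ![crosses [set a; b] _]crossesC => cr1 cr2.
rewrite disjoint_subset; apply/subsetP => z; rewrite in_set2 [z \in predC _]inE.
case/pred2P=> ->; first exact: out cr1 cr2.
by rewrite [[set a; b]]setUC in cr1 cr2; exact: out cr1 cr2.
Qed.

(** If v were no corner, it would be strictly on the inner side of both chords; without a crossing u
    is then on both inner sides as well, and these meet only in the two arcs. *)
Lemma exit_quad u v C D E F : quad C D E F ->
  ~~ crosses [set u; v] [set C; D] -> ~~ crosses [set u; v] [set E; F] ->
  u \notin arc D E :|: arc F C -> v \in arc D E :|: arc F C ->
  v \in [set C; D] :|: [set E; F].
Proof.
move=> q; rewrite ![crosses [set u; v] _]crossesC !crosses_arc => crCD crEF uA vA.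
rewrite in_setU; apply/norP=> -[vCD vEF].
have vDC : v \in arc D C.
  by case/setUP: vA => [/(quad_sub1 q)|/(quad_sub2 (quad_sym q))].
have vFE : v \in arc F E.
  by case/setUP: vA => [/(quad_sub2 q)|/(quad_sub1 (quad_sym q))].
rewrite vCD vDC addbT /= in crCD; rewrite vEF vFE addbT /= in crEF.
have uDC : u \in arc D C.
  move: crCD; have [/set2P[]-> _|_] := boolP (u \in [set C; D]); first exact: arc_r.
    exact: arc_l.
  by rewrite /= negbK.
have uFE : u \in arc F E.
  move: crEF; have [/set2P[]-> _|_] := boolP (u \in [set E; F]); first exact: arc_r.
    exact: arc_l.
  by rewrite /= negbK.
by rewrite (quad_meet q uDC uFE) in uA.
Qed.

(** The cyclic order is C, D, u, E, F, v, so the chord [uv] has [CD] on one side and [EF] on the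
    other. *)
Lemma separates_quad u v p q C D E F : quad C D E F ->
  u \in arc D E -> v \in arc F C ->
  u \notin [set C; D] :|: [set E; F] -> v \notin [set C; D] :|: [set E; F] ->
  p \in [set C; D] -> q \in [set E; F] -> crosses [set u; v] [set p; q].
Proof.
move=> [h cd ef] uA vA uQ vQ pCD qEF.
have neq w z : w \in [set C; D] :|: [set E; F] -> z \notin [set C; D] :|: [set E; F] -> w != z.
  by move=> wQ; apply: contraNneq => <-.
have pQ : p \in [set C; D] :|: [set E; F] by rewrite in_setU pCD.
have qQ : q \in [set C; D] :|: [set E; F] by rewrite in_setU qEF orbT.
rewrite crosses_arc !in_set2 !negb_or !neq //=.
have pvu : p \in arc v u.
  move: uA vA uQ vQ h cd ef; rewrite !mem_arc ccw4E !inE -!val_eqE /=.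
  by case/set2P: pCD => ->; do 3![case: ifPn] => ? ? ? ? ? ? ? /or4P[]/and3P[h1 h2 h3]; lia.
suff /negbTE-> : q \notin arc v u by rewrite pvu.
move: uA vA uQ vQ h cd ef; rewrite !mem_arc ccw4E !inE -!val_eqE /=.
by case/set2P: qEF => ->; do 3![case: ifPn] => ? ? ? ? ? ? ? /or4P[]/and3P[h1 h2 h3]; lia.
Qed.

(** [between] chooses its own labels for the corners. Reversing one chord alone contradicts the
    cyclic order; reversing both forces the chords to coincide and merely exchanges the two arcs. *)
Lemma quad_arcs C D E F C' D' E' F' : quad C D E F -> quad C' D' E' F' ->
  [set C; D] = [set C'; D'] -> [set E; F] = [set E'; F'] ->
  arc D E :|: arc F C = arc D' E' :|: arc F' C'.
Proof.
have flip c d x y : quad c d x y -> ccw4 d c x y -> False.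
  move=> [h cd xy]; move: cd xy h; rewrite !ccw4E -!val_eqE /= => cd xy.
  by case/or4P=> /and3P[h1 h2 h3] /or4P[]/and3P[h1' h2' h3']; lia.
have flip2 c d x y : quad c d x y -> ccw4 d c y x -> x = d /\ y = c.
  move=> [h cd xy] h'; suff [ex ey] : x = d :> nat /\ y = c :> nat by split; apply: ord_inj.
  move: cd xy h h'; rewrite !ccw4E -!val_eqE /= => cd xy.
  by case/or4P=> /and3P[h1 h2 h3] /or4P[]/and3P[h1' h2' h3']; split; lia.
move=> q q' /set2_eq[] [? ?] /set2_eq[] [? ?]; subst=> //.
- by case: (quad_sym q') => /(flip _ _ _ _ (quad_sym q)).
- by case: q' => /(flip _ _ _ _ q).
- by case: q' => /(flip2 _ _ _ _ q)[-> ->] _ _; rewrite setUC.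
Qed.
End Geometry.

(** * Parallel edges *)

Local Opaque crosses.

Section Parallel.
Variables (n : nat) (G : cgraph n).
Implicit Types (a b c d u v x y : 'I_n) (p q : seq 'I_n) (e f g : {set 'I_n}).

Lemma edge_pair e : e \in edges G -> exists x y, x != y /\ e = [set x; y].
Proof. by case/edgesP=> _ /eqP/cards2P. Qed.

Lemma edge_neq x y : [set x; y] \in edges G -> x != y.
Proof. by case/edgesP=> _; rewrite cards2; case: (x != y). Qed.

Lemma parallelP e f : reflect
  [/\ e \in edges G, f \in edges G &
      forall g, g \in edges G -> crosses e g = crosses f g] (parallel G e f).
Proof.
apply: (iffP and3P) => [[eG fG par]|[eG fG par]]; split; try assumption.
  by move=> g gG; exact: (eqP (forall_inP par g gG)).
by apply/forall_inP=> g gG; rewrite par.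
Qed.

Lemma crossedP e : reflect (exists2 f, f \in edges G & crosses e f) (crossed G e).
Proof. exact: exists_inP. Qed.

Local Opaque parallel crossed.

Lemma parallelxx e : e \in edges G -> parallel G e e.
Proof. by move=> eG; apply/parallelP. Qed.

Lemma parallelC e f : parallel G e f = parallel G f e.
Proof.
suff imp e' f' : parallel G e' f' -> parallel G f' e' by apply/idP/idP; exact: imp.
case/parallelP=> eG fG par; apply/parallelP; split; try assumption.
by move=> g gG; rewrite (par g gG).
Qed.

Lemma parallel_trans : transitive (parallel G).
Proof.
move=> f e g /parallelP[eG fG ef] /parallelP[_ gG fg].
apply/parallelP; split; try assumption.
by move=> h hG; rewrite (ef h hG) (fg h hG).
Qed.

Lemma parallelL e f : parallel G e f -> parallel G e =1 parallel G f.
Proof.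
move=> ef g; apply/idP/idP; last exact: parallel_trans ef.
by apply: parallel_trans; rewrite parallelC.
Qed.

Lemma parallel_not_crossed e f : parallel G e f -> crosses e f = false.
Proof. by case/parallelP=> eG fG par; rewrite (par f fG) crossesxx. Qed.

Lemma crossed_parallel e f : parallel G e f -> crossed G e = crossed G f.
Proof.
case/parallelP=> eG fG par; apply/crossedP/crossedP => -[g gG cr]; exists g;
  rewrite ?(par g gG) // -?(par g gG) //.
Qed.

Lemma uncrossedP e f : ~~ crossed G e -> f \in edges G -> crosses f e = false.
Proof.
move=> ne fG; apply: contraNF ne => cr; apply/crossedP.
by exists f; rewrite 1?crossesC.
Qed.

Definition fadj e : rel 'I_n := [rel x y | ([set x; y] \in edges G) &&
  (~~ crossed G [set x; y] || parallel G e [set x; y])].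

Lemma fadj_sym e : symmetric (fadj e).
Proof. by move=> x y; rewrite /fadj /= (setUC [set x]). Qed.

Lemma fconn_sym e : connect_sym (fadj e).
Proof. by apply: sym_connect_sym; apply: fadj_sym. Qed.

Lemma eq_fadj e f : parallel G e f -> fadj e =2 fadj f.
Proof. by move=> ef x y; rewrite /fadj /= (parallelL ef [set x; y]). Qed.

Lemma fconn_parallel e f x y : parallel G e f -> x \in f -> y \in f ->
  connect (fadj e) x y.
Proof.
move=> ef; have /parallelP[_ fG _] := ef; have [u [v [_ eqf]]] := edge_pair fG.
have uv : fadj e u v by rewrite /fadj /= -eqf fG ef orbT.
have vu : fadj e v u by rewrite fadj_sym.
by rewrite eqf !inE => /pred2P[]-> /pred2P[]->; rewrite ?connect0 ?connect1.
Qed.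

(** [joined] without its simple path. Since e and f are themselves edges of [fadj e], the choice of
    their ends is immaterial, and [sim] is an equivalence relation on the edges. *)
Definition sim e f := parallel G e f &&
  [exists x in e, exists y in f, connect (fadj e) x y].

Lemma simP e f : reflect (parallel G e f /\
    forall x y, x \in e -> y \in f -> connect (fadj e) x y) (sim e f).
Proof.
apply: (iffP andP) => -[ef conn]; split=> //.
  move=> x y xe yf; have /exists_inP[x' x'e /exists_inP[y' y'f xy']] := conn.
  have ee : parallel G e e by case/parallelP: ef => eG _ _; apply: parallelxx.
  apply: connect_trans (fconn_parallel ee xe x'e) _.
  exact: connect_trans xy' (fconn_parallel ef y'f yf).
have /parallelP[eG fG _] := ef.
have [u [? [_ eqe]]] := edge_pair eG; have [v [? [_ eqf]]] := edge_pair fG.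
have ue : u \in e by rewrite eqe set21.
have vf : v \in f by rewrite eqf set21.
by apply/exists_inP; exists u => //; apply/exists_inP; exists v => //; apply: conn.
Qed.

Lemma simI e f x y : parallel G e f -> x \in e -> y \in f ->
  connect (fadj e) x y -> sim e f.
Proof.
move=> ef xe yf xy; rewrite /sim ef; apply/exists_inP; exists x => //.
by apply/exists_inP; exists y.
Qed.

Lemma sim_parallel e f : sim e f -> parallel G e f.
Proof. by case/andP. Qed.

Lemma simxx e : e \in edges G -> sim e e.
Proof.
by move=> eG; have ee := parallelxx eG; apply/simP; split=> // x y; apply: fconn_parallel.
Qed.

Lemma sim_sym e f : sim e f -> sim f e.
Proof.
case/simP=> ef conn; apply/simP; rewrite parallelC; split=> // x y xf ye.
rewrite fconn_sym -(eq_connect (eq_fadj ef)); exact: conn.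
Qed.

Lemma sim_trans e f g : sim e f -> sim f g -> sim e g.
Proof.
case/simP=> ef conn /simP[fg conn']; apply/simP; split; first exact: parallel_trans fg.
move=> x y xe yg; have /parallelP[_ fG _] := ef; have [v [? [_ eqf]]] := edge_pair fG.
have vf : v \in f by rewrite eqf set21.
apply: connect_trans (conn x v xe vf) _.
by rewrite (eq_connect (eq_fadj ef)); apply: conn'.
Qed.

Lemma sim_meet e f g x : sim e f -> parallel G e g -> x \in f -> x \in g -> sim e g.
Proof.
case/simP=> ef conn eg xf xg.
have /parallelP[eG _ _] := ef; have [u [? [_ eqe]]] := edge_pair eG.
have ue : u \in e by rewrite eqe set21.
by apply: (simI eg ue xg); apply: conn.
Qed.

Lemma last_path_edges z x (p : seq 'I_n) y :
  last z (path_edges x (rcons p y)) = [set last x p; y].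
Proof. by elim: p x z => [|u p IH] x z //=; rewrite IH. Qed.

Lemma fadj_path e x (p : seq 'I_n) : path (adj G) x p ->
  {in path_edges x p, forall f, ~~ crossed G f || parallel G e f} ->
  path (fadj e) x p.
Proof.
elim: p x => [|y p IH] x //= /andP[xy yp] h.
rewrite -andbA; apply/and3P; split; [exact: xy | exact: h (mem_head _ _) |].
by apply: (IH _ yp) => f fp; apply: h; rewrite in_cons fp orbT.
Qed.

Lemma path_fadj e x (p : seq 'I_n) : path (fadj e) x p -> path (adj G) x p /\
  {in path_edges x p, forall f, ~~ crossed G f || parallel G e f}.
Proof.
elim: p x => [|y p IH] x //= /andP[/andP[xy ok] /IH[yp h]].
split; first by apply/andP.
by move=> f; rewrite in_cons => /predU1P[->|/h].
Qed.

(** The hard direction has to produce a simple path with first edge e and last edge f, although a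
    walk connecting them may visit both ends of e or both ends of f. *)
Lemma joinedP e f : e \in edges G -> joined G e f <-> sim e f.
Proof.
move=> eG; split.
  case=> ef [x [p [/and3P[p0 _ px] hd lst ok]]].
  have fp := fadj_path px ok.
  case/lastP: p => [//|p y] in p0 px hd lst ok fp *.
  rewrite last_path_edges in lst.
  have yf : y \in f by rewrite -lst set22.
  have xe : x \in e by rewrite -hd; case: (p) => [|??] /=; rewrite set21.
  by apply: (simI ef xe yf); apply/connectP; exists (rcons p y); rewrite ?last_rcons.
case/simP=> ef conn; split=> //.
have [fe|fe] := eqVneq f e.
  subst f; have [u [v [uv eqe]]] := edge_pair eG; exists u, [:: v]; split=> //=.
  - by rewrite /is_path /= inE uv /adj /= -eqe eG.
  - by move=> f; rewrite inE => /eqP->; rewrite -eqe ef orbT.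
have /parallelP[_ fG _] := ef.
have [u [v [p [eqe /= /andP[uv fp] uq lf]]]] : exists u v p, [/\ e = [set u; v],
    path (fadj e) u (v :: p), uniq (u :: v :: p) & last v p \in f].
  have [u [v [uv eqe]]] := edge_pair eG; have [w [? [_ eqf]]] := edge_pair fG.
  have euv : fadj e u v by rewrite /fadj /= -eqe eG parallelxx ?orbT.
  have wf : w \in f by rewrite eqf set21.
  have ue : u \in e by rewrite eqe set21.
  have [p0 /shortenP[p fp uq _] ew] := connectP (conn _ _ ue wf).
  (* If the path from u visits the other end v of e, its part before v is replaced by the edge e;
     otherwise e is put in front of it. *)
  have [vp|vp] := boolP (v \in p); last first.
    exists v, u, p; split=> //; first by rewrite eqe setUC.
    - by apply/andP; rewrite fadj_sym.
    - by rewrite cons_uniq uq inE eq_sym negb_or uv vp.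
    - by rewrite /= -ew.
  case/splitPr: vp fp uq ew => p1 p2.
  rewrite cat_path last_cat => /andP[_ /= /andP[_ fp]] uq ew.
  exists u, v, p2; rewrite -[last v p2]ew; split; [exact: eqe | by apply/andP | | exact: wf].
  by move: uq; rewrite cat_uniq mem_cat negb_or => /andP[/andP[_ up2] /and3P[_ _ vp2]];
    apply/andP.
set y := last v p in lf.
have [y' eqf] : exists y', f = [set y; y'].
  have [s [t [? eqf]]] := edge_pair fG; move: lf; rewrite eqf !inE.
  by case/pred2P=> ->; [exists t | exists s; rewrite setUC].
have yy' : fadj e y y' by rewrite /fadj /= -eqf fG ef orbT.
have yNy' : y != y' by apply: edge_neq; rewrite -eqf.
have build u1 v1 q z : e = [set u1; v1] -> path (fadj e) u1 (v1 :: rcons q z) ->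
    uniq (u1 :: v1 :: rcons q z) -> f = [set last v1 q; z] ->
    exists x p, [/\ is_path G x p, head set0 (path_edges x p) = e,
    last set0 (path_edges x p) = f &
    {in path_edges x p, forall g, ~~ crossed G g || parallel G e g}].
  move=> eqe1 fp1 uq1 eqf1; exists u1, (v1 :: rcons q z).
  have [ap ok] := path_fadj fp1.
  by split=> //; rewrite ?/is_path ?ap ?uq1 //= last_path_edges.
have uvp : u \notin v :: p by case/andP: uq.
have uNv : u != v by move: uvp; rewrite in_cons negb_or => /andP[].
(* The path ends at y in f. If it misses y', the edge f is appended; otherwise it is cut at y' and f
   is traversed from y' to y. When y' = u, the first edge is traversed from v to u. *)
have [y'p|y'p] := boolP (y' \in u :: v :: p); last first.
  apply: (build u v p y' eqe _ _ eqf); rewrite -rcons_cons.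
    by rewrite rcons_path; apply/andP; split; [apply/andP | exact: yy'].
  by rewrite -rcons_cons rcons_uniq y'p.
have y'y : fadj e y' y by rewrite fadj_sym.
have yvp : y \in v :: p by apply: mem_last.
have yNu : u != y by apply: contraNneq uvp => ->.
move: y'p; rewrite !in_cons => /or3P[/eqP y'u|/eqP y'v|y'p].
- have yNv : v != y by apply: contraNneq fe => vy; rewrite eqf y'u -vy setUC -eqe.
  apply: (build v u [::] y); first by rewrite eqe setUC.
  + rewrite y'u in y'y; apply/andP; split; first by rewrite fadj_sym.
    by apply/andP.
  + by rewrite /= !inE negb_or [v == u]eq_sym uNv yNv yNu.
  + by rewrite eqf y'u setUC.
- apply: (build u v [::] y eqe).
  + rewrite y'v in y'y; apply/andP; split; first exact: uv.
    by apply/andP.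
  + by rewrite /= !inE negb_or uNv yNu -y'v eq_sym yNy'.
  + by rewrite eqf y'v setUC.
have [p1 [p2 eqp]] : exists p1 p2, p = p1 ++ y' :: p2.
  by case/splitPr: y'p => p1 p2; exists p1, p2.
have yp2 : y \in p2.
  have : y \in y' :: p2 by rewrite /y eqp last_cat /=; apply: mem_last.
  by rewrite in_cons (negbTE yNy').
have eqr : rcons (rcons (v :: p1) y') y = v :: rcons (rcons p1 y') y by [].
apply: (build u v (rcons p1 y') y eqe); rewrite -?eqr.
- rewrite rcons_path last_rcons; apply/andP; split; last exact: y'y.
  have: path (fadj e) u (v :: p) by apply/andP.
  by rewrite eqp -cat_cons -cat_rcons cat_path rcons_cons => /andP[].
- have: uniq (u :: v :: p) by [].
  rewrite eqp -2!cat_cons -cat_rcons cat_uniq -2!rcons_cons => /and3P[uq1 /hasPn/(_ y yp2) yq _].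
  by rewrite rcons_uniq uq1 andbT.
- by rewrite last_rcons eqf setUC.
Qed.
End Parallel.

(** * E-graphs *)

Lemma ccw_sub n (x u v : 'I_n) : ccw x u <= ccw x v -> ccw u v = ccw x v - ccw x u.
Proof.
have := ltn_ord x; have := ltn_ord u; have := ltn_ord v.
by rewrite !ccwE; do 3![case: ifPn]; lia.
Qed.

Lemma crossesI n (a b c d : 'I_n) : 0 < ccw a c < ccw a b -> ccw a b < ccw a d ->
  crosses [set a; b] [set c; d].
Proof.
move=> acb abd; apply/existsP; exists a; apply/existsP; exists b.
by apply/existsP; exists c; apply/existsP; exists d; rewrite !eqxx acb.
Qed.

Lemma crosses_base n (x a b c d : 'I_n) :
  ccw x a < ccw x c < ccw x b -> ccw x b < ccw x d -> crosses [set a; b] [set c; d].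
Proof.
move=> /andP[ac cb] bd; have ab := ltn_trans ac cb; have ad := ltn_trans ab bd.
apply: crossesI; rewrite (ccw_sub (ltnW ab)).
  by rewrite (ccw_sub (ltnW ac)); lia.
by rewrite (ccw_sub (ltnW ad)); lia.
Qed.

Lemma mem_arc_base n (x a b p : 'I_n) : ccw x a <= ccw x p <= ccw x b -> p \in arc a b.
Proof.
move=> /andP[ap pb]; rewrite inE (ccw_sub ap) (ccw_sub (leq_trans ap pb)).
exact: leq_sub2r.
Qed.

Lemma crosses_straddle n (x y : 'I_n) e : crosses [set x; y] e ->
  exists u v, e = [set u; v] /\ ccw x u < ccw x y < ccw x v.
Proof.
case/existsP=> a /existsP[b /existsP[c /existsP[d]]].
case/and4P=> /eqP/set2_eq xy /eqP-> acb abd.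
case: xy => -[eqx eqy].
  by exists c, d; split=> //; rewrite eqx eqy abd andbT; case/andP: acb.
exists d, c; split; first by rewrite setUC.
move: acb abd; rewrite eqx eqy !ccwE.
have := ltn_ord a; have := ltn_ord b; have := ltn_ord c; have := ltn_ord d.
do 6?[case: ifPn]; lia.
Qed.

Section EgraphExists.
Variables (n : nat) (G : cgraph n) (b : {set 'I_n}) (x y : 'I_n).
Hypotheses (bG : b \in edges G) (bx : crosses b [set x; y])
  (xyG : [set x; y] \in edges G).

(** The edge [[set x; y]] crosses b, hence every edge parallel to b. Seen from x, each of them has
    one end before y and one after y, so they form a nested family. The default x is never returned
    on such edges. *)
Let lo (e : {set 'I_n}) := odflt x [pick u in e | ccw x u < ccw x y].
Let hi (e : {set 'I_n}) := odflt x [pick u in e | ccw x y < ccw x u].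

Local Lemma lohi e : parallel G b e ->
  e = [set lo e; hi e] /\ ccw x (lo e) < ccw x y < ccw x (hi e).
Proof.
case/parallelP=> _ _ par.
have cr : crosses [set x; y] e by rewrite crossesC -(par _ xyG).
have [u [v [eqe /andP[ux vx]]]] := crosses_straddle cr.
have -> : lo e = u.
  rewrite /lo; case: pickP => [z|/(_ u)] /=; last by rewrite ux eqe set21.
  rewrite eqe in_set2 => /andP[/pred2P[]-> //].
  by rewrite ltnNge ltnW.
have -> : hi e = v.
  rewrite /hi; case: pickP => [z|/(_ v)] /=; last by rewrite vx eqe set22.
  rewrite eqe in_set2 => /andP[/pred2P[]-> //].
  by rewrite ltnNge ltnW.
by rewrite ux.
Qed.

Let nested e f :=
  (ccw x (lo e) <= ccw x (lo f)) && (ccw x (hi f) <= ccw x (hi e)).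

(** Two such edges that are not nested have interleaved ends and cross, which parallel edges do not.
    The weak inequalities allow common ends. *)
Local Lemma nested_total e f : parallel G b e -> parallel G b f -> nested e f || nested f e.
Proof.
move=> be bf; have [eqe tle] := lohi be; have [eqf tlf] := lohi bf.
have notcr e' f' : parallel G b e' -> parallel G b f' ->
    (ccw x (lo e') < ccw x (lo f')) && (ccw x (hi e') < ccw x (hi f')) = false.
  move=> be' bf'; have [eqe' tle'] := lohi be'; have [eqf' tlf'] := lohi bf'.
  have ef' : parallel G e' f' by apply: parallel_trans bf'; rewrite parallelC.
  have : crosses [set lo e'; hi e'] [set lo f'; hi f'] = false.
    by rewrite -eqe' -eqf'; exact: (parallel_not_crossed ef').
  move=> nocr; apply/idP=> /andP[lt1 lt2]; move: nocr.
  have [tl1 th1] := andP tle'; have [tl2 th2] := andP tlf'.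
  have h : ccw x (lo e') < ccw x (lo f') < ccw x (hi e') by rewrite lt1; apply: ltn_trans tl2 th1.
  by rewrite (crosses_base h lt2).
have := notcr e f be bf; have := notcr f e bf be; rewrite /nested; lia.
Qed.

Local Lemma nested_between e f g : parallel G b e -> parallel G b f -> parallel G b g ->
  nested e g -> nested g f ->
  ccw4 (hi e) (lo e) (lo f) (hi f) /\
  g \subset arc (lo e) (lo f) :|: arc (hi f) (hi e).
Proof.
move=> be bf bg /andP[eg1 eg2] /andP[gf1 gf2].
have [eqe tle] := lohi be; have [eqf tlf] := lohi bf; have [eqg tlg] := lohi bg.
have ef : ccw x (lo e) <= ccw x (lo f) by lia.
have eff : ccw x (lo e) <= ccw x (hi f) by lia.
have efe : ccw x (lo e) <= ccw x (hi e) by lia.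
split; first by rewrite /ccw4 (ccw_sub ef) (ccw_sub eff) (ccw_sub efe); lia.
have log : lo g \in arc (lo e) (lo f) by apply: (@mem_arc_base _ x); rewrite eg1.
have hig : hi g \in arc (hi f) (hi e) by apply: (@mem_arc_base _ x); rewrite gf2.
by rewrite eqg subUset !sub1set !in_setU log hig orbT.
Qed.

(** Sorting the [sim] class of b by nesting gives the order required of the parallel edges; its
    first and last members supply the four corners. *)
Lemma egraph_exists_aux : exists H A1 A2, is_egraph G H A1 A2 /\ b \in H.
Proof.
pose J := enum [set e | sim G b e]; pose s := sort nested J.
have memJ e : (e \in s) = sim G b e by rewrite mem_sort mem_enum inE.
have sP k : k < size s -> parallel G b (nth set0 s k).
  by move=> ks; apply: sim_parallel; rewrite -memJ mem_nth.
have nested_tr : transitive nested.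
  move=> f e g /andP[h1 h2] /andP[h3 h4]; apply/andP; split; first exact: leq_trans h3.
  exact: leq_trans h2.
have srt : sorted nested s.
  apply: (@sort_sorted_in _ (parallel G b)).
    by move=> e f; apply: nested_total.
  by apply/allP=> e; rewrite mem_enum inE; apply: sim_parallel.
have nst i j : i <= j -> j < size s -> nested (nth set0 s i) (nth set0 s j).
  move=> ij js; apply: (sorted_leq_nth nested_tr) => //.
    by move=> e; rewrite /nested !leqnn.
  by rewrite inE; apply: leq_ltn_trans js.
have bs : b \in s by rewrite memJ simxx.
have s0 : 0 < size s by case: (s) bs.
pose e := nth set0 s 0; pose f := nth set0 s (size s).-1.
have ltl : (size s).-1 < size s by rewrite prednK.
have be : parallel G b e by apply: sP.
have bf : parallel G b f by apply: sP.
have mid g : g \in s -> nested e g /\ nested g f.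
  move=> gs; have gi : index g s < size s by rewrite index_mem.
  have := nst _ _ (leq0n _) gi; have := nst (index g s) _ (_ : _ <= (size s).-1) ltl.
  by rewrite nth_index // -ltnS prednK // => /(_ gi) ? ?.
exists [set g in edges G | (g \subset arc (lo e) (lo f) :|: arc (hi f) (hi e)) &&
                           (~~ crossed G g || parallel G b g)].
exists (arc (lo e) (lo f)), (arc (hi f) (hi e)).
have bb := parallelxx bG.
have [h1 h2] := mid b bs; have [c4 bsub] := nested_between be bf bb h1 h2.
split; last by rewrite inE bG bsub bb orbT.
exists b, s, (hi e), (lo e), (lo f), (hi f); split; split.
- exact: bG.
- by apply/crossedP; exists [set x; y].
- split.
  + by rewrite sort_uniq enum_uniq.
  + by move=> g; rewrite memJ; split=> [/joinedP|/joinedP]; apply.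
  + move=> i k j /andP[ik kj] js.
    have ks := leq_ltn_trans kj js; have is_ := leq_ltn_trans ik ks.
    have [c4' sub] := nested_between (sP _ is_) (sP _ js) (sP _ ks) (nst _ _ ik ks) (nst _ _ kj js).
    have [eqi _] := lohi (sP _ is_); have [eqj _] := lohi (sP _ js).
    apply/existsP; exists (hi (nth set0 s i)); apply/existsP; exists (lo (nth set0 s i)).
    apply/existsP; exists (lo (nth set0 s j)); apply/existsP; exists (hi (nth set0 s j)).
    by rewrite c4' sub andbT -eqj eqxx setUC -eqi eqxx.
- by rewrite -nth0 setUC; have [] := lohi be.
- by rewrite -nth_last; have [] := lohi bf.
- exact: c4.
- by split.
- exact: erefl.
Qed.
End EgraphExists.

Lemma egraph_exists n (G : cgraph n) b : b \in edges G -> crossed G b ->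
  exists H A1 A2, is_egraph G H A1 A2 /\ b \in H.
Proof.
move=> bG /crossedP[g gG cr]; have [x [y [_ eqg]]] := edge_pair gG.
by rewrite eqg in gG cr; apply: egraph_exists_aux cr gG.
Qed.

(** A discrete Jordan argument: [crosses_addb] telescopes along the walk, and every term
    vanishes. *)
Lemma walk_not_crossed n (r : rel 'I_n) e x p : path r x p ->
  {in x :: p &, forall u v, r u v -> ~~ crosses e [set u; v]} ->
  {in x :: p, forall z, z \notin e} -> crosses e [set x; last x p] = false.
Proof.
move=> rp; elim: p x rp => [|y p IH] x /=; first by rewrite crosses1.
case/andP=> xy yp nocr off.
have inp z : z \in y :: p -> z \in x :: y :: p by rewrite [z \in x :: _]in_cons orbC => ->.
have offy : {in y :: p, forall z, z \notin e} by move=> z /inp; apply: off.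
have nocry : {in y :: p &, forall u v, r u v -> ~~ crosses e [set u; v]}.
  by move=> u v /inp up /inp vp; apply: nocr.
rewrite (crosses_addb (off _ (mem_head _ _)) (offy _ (mem_head _ _)) (offy _ (mem_last _ _))).
by rewrite (negbTE (nocr _ _ (mem_head _ _) (inp _ (mem_head _ _)) xy)) (IH _ yp).
Qed.

(* The crossing graph on the crossed edges is complete multipartite with two or
   three parts. *)
Definition rank_two n (G : cgraph n) : Prop :=
  [/\ exists2 e, e \in edges G & crossed G e,
      forall e f, e \in edges G -> f \in edges G -> crossed G e -> crossed G f ->
        ~~ crosses e f -> parallel G e f &
      forall e f g h, e \in edges G -> f \in edges G -> g \in edges G -> h \in edges G ->
        crosses e f -> crosses e g -> crosses e h -> crosses f g -> crosses f h ->
        ~~ crosses g h].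

(** * Edges and arcs of an e-graph *)

Section Egraph.
Variables (n : nat) (T : cgraph n).
Implicit Types (u v x y z : 'I_n) (e f g : {set 'I_n}).

Lemma egraph_corners H A1 A2 : is_egraph T H A1 A2 ->
  exists b C D E F, [/\ b \in edges T, crossed T b, quad C D E F,
      sim T b [set C; D] & sim T b [set E; F]] /\
    [/\ A1 = arc D E, A2 = arc F C, forall e, sim T b e -> e \subset A1 :|: A2 &
      H = [set e in edges T | (e \subset A1 :|: A2) &&
                              (~~ crossed T e || parallel T b e)]].
Proof.
case=> b [s [C [D [E [F [[bT bcr [uq sP btw]] [hd lst c4 [-> ->] ->]]]]]]].
have sJ e : e \in s <-> sim T b e.
  by split=> [/sP/(joinedP _ bT)|/(joinedP _ bT)/sP].
have bs : b \in s by apply/sJ/simxx.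
have s0 : 0 < size s by case: (s) bs.
have hs : [set C; D] \in s by rewrite -hd; case: (s) s0 => //= ? ? _; apply: mem_head.
have ls : [set E; F] \in s by rewrite -lst; case: (s) s0 => //= ? ? _; apply: mem_last.
have sCD := proj1 (sJ _) hs; have sEF := proj1 (sJ _) ls.
have /parallelP[_ CDT _] := sim_parallel sCD.
have /parallelP[_ EFT _] := sim_parallel sEF.
have q : quad C D E F by split; [exact: c4 | exact: edge_neq CDT | exact: edge_neq EFT].
exists b, C, D, E, F; split; split; try by [].
move=> e /sJ es.
have ei : index e s < size s by rewrite index_mem.
have := btw 0 (index e s) (size s).-1; rewrite leq0n -ltnS prednK // ei => /(_ isT (leqnn _)).
rewrite nth_index // nth0 nth_last hd lst.
case/existsP=> C' /existsP[D' /existsP[E' /existsP[F' /and4P[/eqP eqCD /eqP eqEF c4' sub]]]].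
rewrite (quad_arcs q _ eqCD eqEF) //; split; first exact: c4'.
  by rewrite eqCD in CDT; apply: edge_neq CDT.
by rewrite eqEF in EFT; apply: edge_neq EFT.
Qed.

(** An interface that forgets the corners. By [eg_sim] the crossed edges of H are exactly the [sim]
    class of b, although H is defined by parallelism and position in the arcs only. By [eg_same] and
    [eg_opp] an edge crossing b separates [A1] from [A2]. *)
Record egraph_facts (H : {set {set 'I_n}}) (A1 A2 b : {set 'I_n}) : Prop := EgraphFacts {
  eg_edge : b \in edges T;
  eg_crossed : crossed T b;
  eg_uncrossed : forall e, e \in edges T -> ~~ crossed T e -> e \subset A1 :|: A2 -> e \in H;
  eg_sim : forall e, (e \in H) && crossed T e = sim T b e;
  eg_disjoint : rank_two T -> forall f, f \in edges T -> crossed T f -> f \notin H ->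
    [disjoint f & A1 :|: A2];
  eg_same : forall g u v, g \in edges T -> crosses g b ->
    u \in A1 -> v \in A1 -> crosses g [set u; v] = false;
  eg_opp : forall g u v, g \in edges T -> crosses g b ->
    u \in A1 -> v \in A2 -> crosses g [set u; v];
  eg_exit : forall u v, [set u; v] \in edges T -> ~~ crossed T [set u; v] ->
    u \notin A1 :|: A2 -> v \in A1 :|: A2 -> exists2 f, sim T b f & v \in f;
  eg_arc : exists D E, A1 = arc D E /\ exists2 f, sim T b f & D \in f }.

Lemma sim_edge b e : sim T b e -> e \in edges T.
Proof. by case/sim_parallel/parallelP. Qed.

Lemma sim_crossed b e : crossed T b -> sim T b e -> crossed T e.
Proof. by move=> bcr /sim_parallel/crossed_parallel<-. Qed.

Lemma sim_crosses b e g : sim T b e -> g \in edges T -> crosses g b = crosses g e.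
Proof.
case/sim_parallel/parallelP=> _ _ par gT.
by rewrite crossesC (par g gT) crossesC.
Qed.

Lemma egraphP H A1 A2 : is_egraph T H A1 A2 -> exists b, egraph_facts H A1 A2 b.
Proof.
case/egraph_corners=> b [C [D [E [F [[bT bcr q sCD sEF] [eqA1 eqA2 simA eqH]]]]]].
exists b.
have disj g : g \in edges T -> crosses g b -> [disjoint g & A1] /\ [disjoint g & A2].
  move=> gT gb; have gCD := gb; have gEF := gb.
  rewrite (sim_crosses sCD gT) in gCD; rewrite (sim_crosses sEF gT) in gEF.
  by rewrite eqA1 eqA2 (cross_quad q gCD gEF) (cross_quad (quad_sym q) gEF gCD).
have same1 g u v : g \in edges T -> crosses g b -> u \in A1 -> v \in A1 ->
    crosses g [set u; v] = false.
  move=> gT /(disj g gT)[dis _] uA vA; rewrite eqA1 in dis uA vA.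
  exact: arc_not_crossed dis uA vA.
have same2 g u v : g \in edges T -> crosses g b -> u \in A2 -> v \in A2 ->
    crosses g [set u; v] = false.
  move=> gT /(disj g gT)[_ dis] uA vA; rewrite eqA2 in dis uA vA.
  exact: arc_not_crossed dis uA vA.
have DA1 : D \in A1 by rewrite eqA1 inE ccwE leqnn subnn.
have CA2 : C \in A2 by rewrite eqA2 inE.
have opp g u v : g \in edges T -> crosses g b -> u \in A1 -> v \in A2 ->
    crosses g [set u; v].
  move=> gT gb uA vA; have [dis1 dis2] := disj g gT gb.
  have off1 z : z \in A1 -> z \notin g by move=> zA; rewrite (disjointFl dis1 zA).
  have off2 z : z \in A2 -> z \notin g by move=> zA; rewrite (disjointFl dis2 zA).
  (* In the walk u, D, C, v only the step along the edge [CD] changes sides of g. *)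
  rewrite (crosses_addb (off1 _ uA) (off1 _ DA1) (off2 _ vA)).
  rewrite (crosses_addb (off1 _ DA1) (off2 _ CA2) (off2 _ vA)).
  rewrite (same1 _ _ _ gT gb uA DA1) (same2 _ _ _ gT gb CA2 vA).
  by rewrite setUC -(sim_crosses sCD gT) gb.
have meets e z : parallel T b e -> z \in e -> z \in [set C; D] :|: [set E; F] -> sim T b e.
  by move=> be ze; rewrite in_setU => /orP[] zf;
    [apply: sim_meet sCD _ zf ze | apply: sim_meet sEF _ zf ze].
have inH e : e \in H -> [/\ e \in edges T, e \subset A1 :|: A2 & ~~ crossed T e || parallel T b e].
  by rewrite eqH inE => /and3P[].
(* Let e in H be parallel to b, with no end at a corner. Some g crosses b and therefore e, so the
   ends of e lie in different arcs and e separates [CD] from [EF]. A walk in [fadj] leads from C to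
   E, and none of its edges crosses e; so it visits an end of e, which joins e to b. *)
have Hsim e : (e \in H) && crossed T e = sim T b e.
  apply/idP/idP => [/andP[/inH[eT sub]]|be]; last first.
    rewrite eqH inE (sim_edge be) (simA _ be) (sim_parallel be) orbT.
    exact: sim_crossed be.
  move=> par ecr; rewrite ecr /= in par; have [g gT bg] := crossedP _ _ bcr.
  have [u [v [uv eqe]]] := edge_pair eT.
  have [ue ve] : u \in e /\ v \in e by rewrite eqe set21 set22.
  have [/(meets _ _ par ue)//|uq] := boolP (u \in [set C; D] :|: [set E; F]).
  have [/(meets _ _ par ve)//|vq] := boolP (v \in [set C; D] :|: [set E; F]).
  have gb : crosses g b by rewrite crossesC.
  have ge : crosses g e.
    by have /parallelP[_ _ pe] := par; rewrite crossesC -(pe _ gT).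
  have crCE : crosses e [set C; E].
    have /orP uA : (u \in A1) || (u \in A2) by rewrite -in_setU (subsetP sub).
    have /orP vA : (v \in A1) || (v \in A2) by rewrite -in_setU (subsetP sub).
    rewrite eqe in ge *; case: uA vA => uA [] vA.
    - by rewrite (same1 _ _ _ gT gb uA vA) in ge; discriminate ge.
    - rewrite eqA1 in uA; rewrite eqA2 in vA.
      exact: separates_quad q uA vA uq vq (set21 _ _) (set21 _ _).
    - rewrite eqA2 in uA; rewrite eqA1 in vA; rewrite setUC.
      exact: separates_quad q vA uA vq uq (set21 _ _) (set21 _ _).
    - by rewrite (same2 _ _ _ gT gb uA vA) in ge; discriminate ge.
  have sCE : sim T [set C; D] [set E; F] by apply: sim_trans sEF; apply: sim_sym.
  have /simP[_ /(_ C E (set21 _ _) (set21 _ _)) conn] := sCE.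
  have CDe : parallel T [set C; D] e.
    by apply: parallel_trans par; rewrite parallelC; apply: sim_parallel.
  have [p fp eqE] := connectP conn.
  have [/hasP[z zp ze]|/hasPn off] := boolP (has (mem e) (C :: p)).
    apply: sim_trans sCD _; apply: (simI CDe (set21 _ _) ze).
    exact: path_connect fp _ zp.
  suff nocr u' v' : fadj T [set C; D] u' v' -> ~~ crosses e [set u'; v'].
    have absurd := walk_not_crossed fp (in2W nocr) off.
    by rewrite -eqE crCE in absurd; discriminate absurd.
  case/andP=> uvT /orP[unc|par'].
    by rewrite (uncrossedP unc eT).
  suff par2 : parallel T e [set u'; v'] by rewrite (parallel_not_crossed par2).
  by apply: parallel_trans par'; rewrite parallelC.
have exit1 u v : [set u; v] \in edges T -> crosses [set u; v] [set C; D] = false ->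
    crosses [set u; v] [set E; F] = false -> u \notin A1 :|: A2 -> v \in A1 :|: A2 ->
    v \in [set C; D] :|: [set E; F].
  move=> uvT cr1 cr2; rewrite eqA1 eqA2; apply: (exit_quad q); first by rewrite cr1.
  by rewrite cr2.
split.
- exact: bT.
- exact: bcr.
- by move=> e eT ecr sub; rewrite eqH inE eT sub ecr.
- exact: Hsim.
- case=> _ cross_or_par _ f fT fcr fH.
  have [fb|fb] := boolP (crosses f b).
    have [dis1 dis2] := disj f fT fb.
    by rewrite -setI_eq0 setIUr setU_eq0 !setI_eq0 dis1.
  (* As f is parallel to b but not in H, it has an end u outside the arcs. By [exit1] the other end
     could lie in the arcs only at a corner, and this would join f to b. *)
  have bf : parallel T b f by rewrite parallelC; apply: cross_or_par.
  have nsim : ~~ sim T b f by rewrite -Hsim negb_and fH.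
  have CDf : crosses f [set C; D] = false.
    by rewrite -(sim_crosses sCD fT); apply: negbTE.
  have EFf : crosses f [set E; F] = false.
    by rewrite -(sim_crosses sEF fT); apply: negbTE.
  have nsub : ~~ (f \subset A1 :|: A2).
    by apply: contra fH => sub; rewrite eqH inE fT sub bf orbT.
  have [u uf uA] := subsetPn nsub.
  have [v eqf] : exists v, f = [set u; v].
    have [s [t [? eqf]]] := edge_pair fT; move: uf; rewrite eqf !inE.
    by case/pred2P=> ->; [exists t | exists s; rewrite setUC].
  have vf : v \in f by rewrite eqf set22.
  rewrite eqf in fT CDf EFf.
  have vA : v \notin A1 :|: A2.
    by apply: contra nsim => vA; apply: (meets _ v) => //; apply: exit1 fT CDf EFf uA vA.
  rewrite disjoint_subset eqf; apply/subsetP => z.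
  by rewrite in_set2 => /pred2P[]->; rewrite inE.
- exact: same1.
- exact: opp.
- move=> u v uvT unc uA vA.
  have cr1 : crosses [set u; v] [set C; D] = false.
    by rewrite crossesC; apply: uncrossedP unc (sim_edge sCD).
  have cr2 : crosses [set u; v] [set E; F] = false.
    by rewrite crossesC; apply: uncrossedP unc (sim_edge sEF).
  have := exit1 u v uvT cr1 cr2 uA vA.
  by rewrite in_setU => /orP[] vf; [exists [set C; D] | exists [set E; F]].
- by exists D, E; split=> //; exists [set C; D]; rewrite ?set22.
Qed.
End Egraph.

(** * The reduced form *)

Section RankTwo.
Variable n : nat.
Implicit Types (G : cgraph n) (e f g : {set 'I_n}).

Lemma crossed_sub G G' e : edges G' \subset edges G -> crossed G' e -> crossed G e.
Proof.
by move=> /subsetP sub /crossedP[f /sub fG cr]; apply/crossedP; exists f.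
Qed.

(** Deleting edges only removes tests from [parallel]; what can get lost is the existence of a
    crossed edge. *)
Lemma rank_two_sub G G' : edges G' \subset edges G ->
  (exists2 e, e \in edges G' & crossed G' e) -> rank_two G -> rank_two G'.
Proof.
move=> sub ex [_ par clique]; have inG e : e \in edges G' -> e \in edges G by apply: subsetP.
split; first exact: ex.
  move=> e f eG fG ecr fcr ef.
  have /parallelP[_ _ pe] := par e f (inG e eG) (inG f fG)
    (crossed_sub sub ecr) (crossed_sub sub fcr) ef.
  by apply/parallelP; split; [exact: eG | exact: fG | move=> g gG; exact: pe (inG g gG)].
move=> e f g h eG fG gG hG; exact: clique (inG e eG) (inG f fG) (inG g gG) (inG h hG).
Qed.

Lemma rank_two_add G G' : edges G \subset edges G' ->
  (forall e, e \in edges G' -> e \notin edges G -> ~~ crossed G' e) ->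
  rank_two G -> rank_two G'.
Proof.
move=> sub unc [[e0 e0G e0cr] par clique].
have inG e f : e \in edges G' -> f \in edges G' -> crosses e f -> e \in edges G /\ f \in edges G.
  move=> eG fG ef; split; last rewrite crossesC in ef.
    by case: (boolP (e \in edges G)) => // /(unc e eG)/uncrossedP/(_ fG); rewrite crossesC ef.
  by case: (boolP (f \in edges G)) => // /(unc f fG)/uncrossedP/(_ eG); rewrite crossesC ef.
have crG e : e \in edges G' -> crossed G' e -> e \in edges G /\ crossed G e.
  move=> eG /crossedP[f fG ef]; have [eG1 fG1] := inG e f eG fG ef.
  by split; [exact: eG1 | apply/crossedP; exists f].
split.
- by exists e0; [apply: subsetP e0G | apply: crossed_sub sub e0cr].
- move=> e f eG fG /(crG e eG)[eG1 ecr] /(crG f fG)[fG1 fcr] ef.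
  have /parallelP[_ _ pe] := par e f eG1 fG1 ecr fcr ef.
  apply/parallelP; split; [exact: eG | exact: fG | move=> g gG].
  have [g1|g1] := boolP (g \in edges G); first exact: pe.
  by have uncg := unc g gG g1; rewrite (uncrossedP uncg eG) (uncrossedP uncg fG).
- move=> e f g h eG fG gG hG ef eg eh fg fh.
  have [eG1 fG1] := inG _ _ eG fG ef; have [_ gG1] := inG _ _ eG gG eg.
  have [_ hG1] := inG _ _ eG hG eh.
  exact: (clique e f g h).
Qed.
End RankTwo.

Section Reduction.
Variables (n : nat) (T T1 T2 : cgraph n).
Hypotheses (st1 : step1 T T1) (st2 : step2 T1 T2).
Implicit Types (u v x y z a b : 'I_n) (e f g h k : {set 'I_n}) (H K : {set {set 'I_n}}).

Lemma kept_sub : edges T2 \subset edges T.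
Proof.
case: st1 st2 => _ sub _ _ [eq2 _]; apply: subset_trans sub.
by rewrite eq2; apply/subsetP=> e; rewrite inE => /andP[].
Qed.

Lemma kept_crossed e : e \in edges T2 -> e \in edges T /\ crossed T e.
Proof.
case: st1 st2 => _ sub _ _ [-> _]; rewrite inE => /andP[eT1 ecr].
by split; [apply: (subsetP sub) | apply: crossed_sub sub ecr].
Qed.

Lemma step1_repr e : e \in edges T -> crossed T e -> exists2 f, f \in edges T1 & parallel T e f.
Proof.
move=> eT ecr; case: st1 => _ _ _ one; have [H [A1 [A2 [eg eH]]]] := egraph_exists eT ecr.
have [b facts] := egraphP eg.
have /one/eqP/cards1P[f eqf] : egraph T H by exists A1, A2.
have : f \in parallel_edges T H :&: edges T1 by rewrite eqf set11.
rewrite inE => /andP[]; rewrite inE => fH fT1; exists f => //.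
rewrite (eg_sim facts) in fH; apply: parallel_trans (sim_parallel fH).
by rewrite parallelC; apply: sim_parallel; rewrite -(eg_sim facts) eH.
Qed.

(** The edge kept from the e-graph of e is crossed by the kept representative of any edge crossing
    e, so it survives step 2. *)
Lemma kept_repr e : e \in edges T -> crossed T e -> exists2 f, f \in edges T2 & parallel T e f.
Proof.
move=> eT ecr; have [f fT1 ef] := step1_repr eT ecr; exists f => //.
case: st2 => -> _; rewrite inE fT1; apply/crossedP.
have [g gT eg] := crossedP _ _ ecr.
have gcr : crossed T g by apply/crossedP; exists e; rewrite // crossesC.
have [g' gT1 gg] := step1_repr gT gcr; exists g' => //.
have /parallelP[_ fT pe] := ef; have /parallelP[_ _ pg] := gg.
by rewrite crossesC -(pg _ fT) crossesC -(pe _ gT).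
Qed.

Lemma kept_uniq H A1 A2 h k : is_egraph T H A1 A2 -> h \in H -> k \in H ->
  h \in edges T2 -> k \in edges T2 -> h = k.
Proof.
move=> eg hH kH hT kT; case: (st1) => _ _ _ one.
have /one/eqP/cards1P[f eqf] : egraph T H by exists A1, A2.
have in1 e : e \in H -> e \in edges T2 -> e = f.
  move=> eH eT; have [_ ecr] := kept_crossed eT.
  have eT1 : e \in edges T1 by case: st2 eT => -> _; rewrite inE => /andP[].
  by apply/set1P; rewrite -eqf !inE eH ecr.
by rewrite (in1 h) // (in1 k).
Qed.

Lemma kept_crosses e f e' f' : parallel T e e' -> parallel T f f' -> crosses e f = crosses e' f'.
Proof.
case/parallelP=> _ eT' pe /parallelP[fT _ pf].
by rewrite (pe _ fT) crossesC (pf _ eT') crossesC.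
Qed.

Lemma rank_two_kept : rank_two T <-> rank_two T2.
Proof.
split=> [r2|[[e0 e0T e0cr] par clique]].
  have [[e eT ecr] _ _] := r2; apply: rank_two_sub kept_sub _ r2.
  have [f fT2 ef] := kept_repr eT ecr.
  exists f => //; have [g gT eg] := crossedP _ _ ecr.
  have gcr : crossed T g by apply/crossedP; exists e; rewrite // crossesC.
  have [g' gT2 gg] := kept_repr gT gcr; apply/crossedP; exists g' => //.
  by rewrite -(kept_crosses ef gg).
have crossed2 e f : e \in edges T -> crossed T e -> f \in edges T2 ->
    parallel T e f -> crossed T2 f.
  move=> eT ecr fT2 ef; have [g gT eg] := crossedP _ _ ecr.
  have gcr : crossed T g by apply/crossedP; exists e; rewrite // crossesC.
  have [g' gT2 gg] := kept_repr gT gcr; apply/crossedP; exists g' => //.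
  by rewrite -(kept_crosses ef gg).
have crossI e f : e \in edges T -> f \in edges T -> crosses e f -> crossed T e /\ crossed T f.
  by move=> eT fT ef; split; apply/crossedP; [exists f | exists e; rewrite // crossesC].
split.
- by have [? ?] := kept_crossed e0T; exists e0.
- move=> e f eT fT ecr fcr ef.
  have [e' e'T ee] := kept_repr eT ecr; have [f' f'T ff] := kept_repr fT fcr.
  have e'cr := crossed2 _ _ eT ecr e'T ee; have f'cr := crossed2 _ _ fT fcr f'T ff.
  have ef' : ~~ crosses e' f' by rewrite -(kept_crosses ee ff).
  have /parallelP[_ _ pe] := par e' f' e'T f'T e'cr f'cr ef'.
  have /parallelP[_ _ pee] := ee; have /parallelP[_ _ pff] := ff.
  apply/parallelP; split; [exact: eT | exact: fT | move=> g gT].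
  have [gcr|gunc] := boolP (crossed T g); last first.
    by rewrite (uncrossedP gunc eT) (uncrossedP gunc fT).
  have [g' g'T gg] := kept_repr gT gcr.
  by rewrite (kept_crosses ee gg) (kept_crosses ff gg); apply: pe.
- move=> e f g h eT fT gT hT ef eg eh fg fh; apply/negP=> gh.
  have [ecr fcr] := crossI _ _ eT fT ef; have [gcr hcr] := crossI _ _ gT hT gh.
  have [e' e'T ee] := kept_repr eT ecr; have [f' f'T ff] := kept_repr fT fcr.
  have [g' g'T gg] := kept_repr gT gcr; have [h' h'T hh] := kept_repr hT hcr.
  have := clique e' f' g' h' e'T f'T g'T h'T.
  rewrite -(kept_crosses ee ff) -(kept_crosses ee gg) -(kept_crosses ee hh).
  rewrite -(kept_crosses ff gg) -(kept_crosses ff hh) -(kept_crosses gg hh).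
  by rewrite ef eg eh fg fh gh => /(_ isT isT isT isT isT).
Qed.
End Reduction.

(** * The edges added in step 3 *)

Lemma crosses_share n (a b : 'I_n) (f : {set 'I_n}) : a \in f -> crosses f [set a; b] = false.
Proof.
move=> af; case cr: (crosses _ _) => //.
by have := set21 a b; rewrite (disjointFr (crosses_disjoint cr) af).
Qed.

Section Links.
Variables (n : nat) (T T1 T2 : cgraph n).
Hypotheses (st1 : step1 T T1) (st2 : step2 T1 T2) (r2 : rank_two T).
Implicit Types (u v x y z a b : 'I_n) (p q : seq 'I_n) (A B e f g h k : {set 'I_n}).
Implicit Types (H K L : {set {set 'I_n}}).

Definition uadj : rel 'I_n :=
  [rel u v | ([set u; v] \in edges T) && ~~ crossed T [set u; v]].

Lemma uadj_sym : symmetric uadj.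
Proof. by move=> u v; rewrite /uadj /= (setUC [set u]). Qed.

Lemma mem_coverI H e v : e \in H -> v \in e -> v \in cover H.
Proof. by move=> eH ve; apply/bigcupP; exists e. Qed.

(* h = {a, a2} is the kept edge of the e-graph H, which contains c, and x is the
   end in the arc A of a path leaving H. *)
Record half_link H A a x h (c : {set 'I_n}) A2 a2 : Prop := HalfLink {
  hl_egraph : is_egraph T H A A2;
  hl_facts : egraph_facts T H A A2 c;
  hl_rep : h = [set a; a2];
  hl_inH : h \in H;
  hl_kept : h \in edges T2;
  hl_a : a \in A;
  hl_a2 : a2 \in A2;
  hl_x : x \in A;
  hl_end : exists2 f, sim T c f & x \in f }.

Definition half H A a x h := exists c A2 a2, half_link H A a x h c A2 a2.

(** The data behind an added edge [[set a; b]], symmetric in its two ends ([link_sym]). The field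
    [lk_cross] does not come from step 3; [link_of_new_edge] derives it from rank two. *)
Record link H A a x h K B b y k p : Prop := Link {
  lk_left : half H A a x h;
  lk_right : half K B b y k;
  lk_path : path uadj x p;
  lk_last : last x p = y;
  lk_uniq : uniq (x :: p);
  lk_onlyl : {in x :: p, forall v, v \in cover H -> v = x};
  lk_onlyr : {in x :: p, forall v, v \in cover K -> v = y};
  lk_other : forall L, egraph T L -> L <> H -> L <> K -> {in x :: p, forall v, v \notin cover L};
  lk_cross : crosses h k }.

Lemma half_egraph H A a x h : half H A a x h -> egraph T H.
Proof. by case=> b [A2 [a2 [? _ _ _ _ _ _ _ _]]]; exists A, A2. Qed.

Lemma half_x H A a x h : half H A a x h -> x \in A /\ x \in cover H.
Proof.
case=> b [A2 [a2 [_ facts _ _ _ _ _ xA [f bf xf]]]]; split=> //.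
apply: mem_coverI xf; by move: bf; rewrite -(eg_sim facts) => /andP[].
Qed.

Lemma half_rep H A a x h : half H A a x h ->
  [/\ h \in H, h \in edges T2, h \in edges T, crossed T h & a \in h].
Proof.
case=> b [A2 [a2 [_ facts eqh hH hT2 _ _ _ _]]].
by have [hT hcr] := kept_crossed st1 st2 hT2; rewrite {5}eqh set21.
Qed.

Lemma half_same H A a x h g u v : half H A a x h -> [disjoint g & A] ->
  u \in A -> v \in A -> crosses g [set u; v] = false.
Proof.
case=> b [A2 [a2 [_ facts _ _ _ _ _ _ _]]] dis uA vA.
have [D [E [eqA _]]] := eg_arc facts; rewrite eqA in dis uA vA.
exact: arc_not_crossed dis uA vA.
Qed.

Lemma half_off H A a x h f z : half H A a x h -> f \in edges T -> crossed T f ->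
  f \notin H -> z \in A -> z \notin f.
Proof.
case=> b [A2 [a2 [_ facts _ _ _ _ _ _ _]]] fT fcr fH zA.
by rewrite (disjointFl (eg_disjoint facts r2 fT fcr fH)) // in_setU zA.
Qed.

Lemma half_uniq H A a x h f : half H A a x h -> f \in H -> f \in edges T2 -> f = h.
Proof.
case=> b [A2 [a2 [eg _ _ hH hT _ _ _ _]]] fH fT.
exact: (kept_uniq st1 st2 eg fH hH fT hT).
Qed.

Lemma cross_notin H A a x h g : half H A a x h -> g \in edges T -> crosses g h -> g \notin H.
Proof.
move=> hl gT gh; have [hH _ hT hcr _] := half_rep hl.
case: hl => b [A2 [a2 [_ facts _ _ _ _ _ _ _]]].
have gcr : crossed T g by apply/crossedP; exists h.
apply/negP=> gH.
have /sim_parallel bg : sim T b g by rewrite -(eg_sim facts) gH gcr.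
have /sim_parallel bh : sim T b h by rewrite -(eg_sim facts) hH hcr.
have : parallel T g h by apply: parallel_trans bh; rewrite parallelC.
by move/parallel_not_crossed; rewrite gh.
Qed.

(** If the arcs meet, the start of one of them lies in the other. This start is an end of an edge of
    its e-graph, which then belongs to both e-graphs, so the kept edges coincide and a, a' are the
    two ends of one kept edge. An edge g crossing it separates a from a', yet each arc stays on one
    side of g and the arcs share a point. *)
Lemma half_disjoint H A a x h H' A' a' x' h' : half H A a x h -> half H' A' a' x' h' ->
  a <> a' -> [disjoint A & A'].
Proof.
have aux H1 A1 a1 x1 h1 H3 A3 a3 x3 h3 : half H1 A1 a1 x1 h1 -> half H3 A3 a3 x3 h3 ->
    a1 <> a3 -> forall z, z \in A1 -> z \in A3 ->
    forall D E, A1 = arc D E ->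
    forall (b1 : {set 'I_n}) A2 a2, half_link H1 A1 a1 x1 h1 b1 A2 a2 ->
    forall f, sim T b1 f -> D \in f -> D \in A3 -> False.
  move=> hl1 hl3 neq z z1 z3 D E eqA b1 A2 a2 hb1 f bf Df D3.
  have facts := hl_facts hb1.
  have fT := sim_edge bf; have fcr := sim_crossed (eg_crossed facts) bf.
  have [f3|/(half_off hl3 fT fcr)/(_ D3)] := boolP (f \in H3); last by rewrite Df.
  have [h3H h3T2 h3T h3cr a3h] := half_rep hl3.
  have [h1H _ h1T h1cr _] := half_rep hl1.
  have [b3 [B2 [c3 hb3]]] := hl3; have facts3 := hl_facts hb3.
  have s3f : sim T b3 f by rewrite -(eg_sim facts3) f3 fcr.
  have s3h : sim T b3 h3 by rewrite -(eg_sim facts3) h3H h3cr.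
  have s13 : sim T b1 b3 by apply: sim_trans bf (sim_sym s3f).
  have h31 : h3 = h1.
    apply: (half_uniq hl1 _ h3T2).
    by have := sim_trans s13 s3h; rewrite -(eg_sim facts) => /andP[].
  have a32 : a3 = a2.
    by move: a3h; rewrite h31 (hl_rep hb1) in_set2 => /pred2P[/esym/neq|].
  have [g gT bg] := crossedP _ _ (eg_crossed facts); rewrite crossesC in bg.
  have gcr : crossed T g by apply/crossedP; exists b1 => //; apply: eg_edge facts.
  have s1h : sim T b1 h1 by rewrite -(eg_sim facts) h1H h1cr.
  have gh : crosses g h1 by rewrite -(sim_crosses s1h gT).
  have off w : w \in A1 -> w \notin g.
    by apply: (half_off hl1 gT gcr); apply: (cross_notin hl1 gT gh).
  have off3 w : w \in A3 -> w \notin g.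
    by apply: (half_off hl3 gT gcr); apply: (cross_notin hl3 gT); rewrite h31.
  have gb3 : crosses g b3 by rewrite -(sim_crosses s13 gT).
  have a1A := hl_a hb1; have a3A := hl_a hb3.
  have := eg_opp facts gT bg a1A (hl_a2 hb1).
  rewrite -a32 (crosses_addb (off _ a1A) (off _ z1) (off3 _ a3A)).
  by rewrite (eg_same facts gT bg a1A z1) (eg_same facts3 gT gb3 z3 a3A).
move=> hl hl' neq; rewrite -setI_eq0; apply/eqP/setP=> z; rewrite in_setI in_set0.
apply/idP=> /andP[zA zA'].
have [b [A2 [a2 hb]]] := hl; have [b' [A2' [a2' hb']]] := hl'.
have [D [E [eqA [f bf Df]]]] := eg_arc (hl_facts hb).
have [D' [E' [eqA' [f' bf' Df']]]] := eg_arc (hl_facts hb').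
have := zA; have := zA'; rewrite {1}eqA {1}eqA' => z1 z2.
case/orP: (arc_meet z2 z1); rewrite -?eqA -?eqA' => DA.
  exact: (aux _ _ _ _ _ _ _ _ _ _ hl hl' neq z zA zA' D E eqA _ _ _ hb f bf Df DA).
have neq' : a' <> a by move/esym.
exact: (aux _ _ _ _ _ _ _ _ _ _ hl' hl neq' z zA' zA D' E' eqA' _ _ _ hb' f' bf' Df' DA).
Qed.

Lemma link_sym H A a x h K B b y k p : link H A a x h K B b y k p ->
  exists q, link K B b y k H A a x h q /\ (y :: q) =i (x :: p).
Proof.
case=> hl hr rp lst uq ol orr oth cr; exists (rev (belast x p)).
have rcp : rev (x :: p) = y :: rev (belast x p) by rewrite lastI rev_rcons lst.
have mem z : (z \in y :: rev (belast x p)) = (z \in x :: p) by rewrite -rcp mem_rev.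
split; last exact: mem.
split; [exact: hr | exact: hl | | | | | | | by rewrite crossesC].
- rewrite -lst rev_path; apply: sub_path rp => u v.
  by rewrite uadj_sym.
- by rewrite -[last _ _]/(last y (y :: rev (belast x p))) -rcp rev_cons last_rcons.
- by rewrite -rcp rev_uniq.
- by move=> v; rewrite mem; apply: orr.
- by move=> v; rewrite mem; apply: ol.
- by move=> L eL LK LH v; rewrite mem; apply: oth.
Qed.

Lemma uadj_not_crossed e u v : e \in edges T -> uadj u v -> ~~ crosses e [set u; v].
Proof. by move=> eT /andP[_ unc]; rewrite (uncrossedP unc eT). Qed.

(** If f is h or k, it shares an end with the added edge. Otherwise f belongs to a third e-graph and
    has no end on the arcs or the path, so the walk from a in A to x, along the path to y, and in B
    to b never changes sides of f. *)
Lemma kept_not_crossed_link H A a x h K B b y k p f : link H A a x h K B b y k p ->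
  f \in edges T2 -> crosses f [set a; b] = false.
Proof.
case=> hl hr rp lst uq ol orr oth cr fT2.
have [fT fcr] := kept_crossed st1 st2 fT2.
have [hH hT2 hT hcr ah] := half_rep hl; have [kK kT2 kT kcr bk] := half_rep hr.
have [fH|fH] := boolP (f \in H).
  by rewrite (half_uniq hl fH fT2) crosses_share.
have [fK|fK] := boolP (f \in K).
  by rewrite (half_uniq hr fK fT2) setUC crosses_share.
have [L [C1 [C2 [eL fL]]]] := egraph_exists fT fcr.
have LH : L <> H by move=> eq; rewrite -eq fL in fH.
have LK : L <> K by move=> eq; rewrite -eq fL in fK.
have off : {in x :: p, forall v, v \notin f}.
  have eL' : egraph T L by exists C1, C2.
  by move=> v vp; apply: contra (oth L eL' LH LK v vp); apply: mem_coverI.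
have [xA _] := half_x hl; have [yB _] := half_x hr.
have [c [A2 [a2 hla]]] := hl; have [d [B2 [b2 hlb]]] := hr.
have offA v : v \in A -> v \notin f by apply: half_off hl fT fcr fH.
have offB v : v \in B -> v \notin f by apply: half_off hr fT fcr fK.
have aA := hl_a hla; have bB := hl_a hlb.
rewrite (crosses_addb (offA _ aA) (offA _ xA) (offB _ bB)).
rewrite (crosses_addb (offA _ xA) (offB _ yB) (offB _ bB)).
have disA : [disjoint f & A].
  by rewrite disjoint_sym disjoint_subset; apply/subsetP => v /offA; rewrite inE.
have disB : [disjoint f & B].
  by rewrite disjoint_sym disjoint_subset; apply/subsetP => v /offB; rewrite inE.
rewrite (half_same hl disA aA xA) (half_same hr disB yB bB) -lst.
by rewrite (walk_not_crossed rp (in2W (fun u v => @uadj_not_crossed f u v fT)) off).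
Qed.

(** A vertex of K on the second path forces K to be H' or K', and y to be x' or y' accordingly; but
    then two disjoint arcs would share y. *)
Lemma link_end_notin H A a x h K B b y k p H' A' a' x' h' K' B' b' y' k' p' :
  link H A a x h K B b y k p -> link H' A' a' x' h' K' B' b' y' k' p' ->
  b <> a' -> b <> b' -> y \notin x' :: p'.
Proof.
move=> [hl hr _ _ _ _ _ _ _] [hl' hr' _ _ _ ol' or' oth' _] ba bb; apply/negP=> yp.
have [yB yK] := half_x hr; have [xA' _] := half_x hl'; have [yB' _] := half_x hr'.
have dA := half_disjoint hr hl' ba; have dB := half_disjoint hr hr' bb.
have [eqK|/eqP KH] := eqVneq K H'.
  have yx : y = x' by apply: (ol' y yp); rewrite -eqK.
  by rewrite -yx (disjointFr dA yB) in xA'.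
have [eqK|/eqP KK] := eqVneq K K'.
  have yy : y = y' by apply: (or' y yp); rewrite -eqK.
  by rewrite -yy (disjointFr dB yB) in yB'.
by have := oth' K (half_egraph hr) KH KK y yp; rewrite yK.
Qed.

(** If the paths met in u, uncrossed edges would connect x to x', so h and h' would lie in one
    e-graph and coincide, with a and a' as the two ends. Then k separates a from a', but the walk
    from a through x, u and x' to a' never changes sides of k. *)
Lemma link_parallel_disjoint H A a x h K B b y k p H' A' a' x' h' K' B' b' y' k' p' u :
  link H A a x h K B b y k p -> link H' A' a' x' h' K' B' b' y' k' p' ->
  a <> a' -> a <> b' -> b <> a' -> b <> b' ->
  parallel T h h' -> u \in x :: p -> u \in x' :: p' -> False.
Proof.
move=> lk lk' aa ab ba bb par up up'.
have uy : u != y.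
  by apply: contraNneq (link_end_notin lk lk' ba bb) => <-.
have uy' : u != y'.
  have ba' : b' <> a by move/esym. have bb' : b' <> b by move/esym.
  by apply: contraNneq (link_end_notin lk' lk ba' bb') => <-.
have [hl hr rp lst uq ol orr oth cr] := lk.
have [hl' hr' rp' lst' uq' ol' or' oth' cr'] := lk'.
(* The paths are cut at u, before their last vertices: only y meets [cover K] on the first path, and
   on the second path y' could do so when K = K'. The remaining parts avoid the ends of k. *)
have prefix q z w : path uadj z q -> uniq (z :: q) -> w \in z :: q -> w != last z q ->
    exists q1, [/\ path uadj z q1, last z q1 = w &
                   {in z :: q1, forall v, v \in z :: q /\ v <> last z q}].
  move=> zq uzq wq; case/splitPl: wq zq uzq => q1 q2 <-.
  rewrite cat_path last_cat => /andP[z1 _] uz neq; exists q1; split=> // v v1.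
  split; first by rewrite -cat_cons mem_cat v1.
  move: uz; rewrite -cat_cons cat_uniq => /and3P[_ /hasPn no _] vl.
  case: q2 neq no vl => [|w2 q2] /=; first by rewrite eqxx.
  by move=> _ no vl; have := no _ (mem_last w2 q2); rewrite /= -vl v1.
rewrite -lst in uy; rewrite -lst' in uy'.
have [q [uq1 lq inq]] := prefix _ _ _ rp uq up uy.
have [q' [uq1' lq' inq']] := prefix _ _ _ rp' uq' up' uy'.
rewrite lst in inq; rewrite lst' in inq'.
have [hH hT2 hT hcr ah] := half_rep hl; have [h'H h'T2 h'T h'cr ah'] := half_rep hl'.
have [kK kT2 kT kcr bk] := half_rep hr.
have [c [A2 [a2 hla]]] := hl; have [c' [A2' [a2' hla']]] := hl'.
have facts := hl_facts hla; have facts' := hl_facts hla'.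
have ch : sim T c h by rewrite -(eg_sim facts) hH hcr.
have ch' : sim T c' h' by rewrite -(eg_sim facts') h'H h'cr.
have [f cf xf] := hl_end hla; have [f' cf' xf'] := hl_end hla'.
have conn : connect uadj x x'.
  apply: (@connect_trans _ _ u); first by apply/connectP; exists q.
  rewrite (sym_connect_sym uadj_sym); by apply/connectP; exists q'.
have cp : parallel T c f'.
  apply: parallel_trans (sim_parallel ch) _; apply: parallel_trans par _.
  by apply: parallel_trans (sim_parallel cf'); rewrite parallelC; apply: sim_parallel.
have sf' : sim T c f'.
  have ff' : parallel T f f'.
    by apply: parallel_trans cp; rewrite parallelC; exact: (sim_parallel cf).
  apply: (sim_trans cf); apply: (simI ff' xf xf').
  by apply: connect_sub conn => v w /andP[vT unc]; apply: connect1; apply/andP; rewrite unc.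
have sh' : sim T c h' by apply: sim_trans sf' (sim_trans (sim_sym cf') ch').
have h'h : h' = h.
  by apply: (half_uniq hl _ h'T2); move: sh'; rewrite -(eg_sim facts) => /andP[].
have a'2 : a' = a2.
  by move: ah'; rewrite h'h (hl_rep hla) in_set2 => /pred2P[/esym/aa|].
have kh : crosses k h by rewrite crossesC.
have kh' : crosses k h' by rewrite h'h.
have kH := cross_notin hl kT kh; have kH' := cross_notin hl' kT kh'.
have offA v : v \in A -> v \notin k by apply: half_off hl kT kcr kH.
have offA' v : v \in A' -> v \notin k by apply: half_off hl' kT kcr kH'.
have kc : crosses k c by rewrite (sim_crosses ch kT).
have kc' : crosses k c' by rewrite (sim_crosses ch' kT).
have offq : {in x :: q, forall v, v \notin k}.
  move=> v /inq[vp vy]; apply/negP=> vk; apply: vy; apply: (orr v vp).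
  exact: mem_coverI kK vk.
have offq' : {in x' :: q', forall v, v \notin k}.
  move=> v /inq'[vp vy]; apply/negP=> vk; have vK := mem_coverI kK vk.
  have KH : K <> H' by move=> eq; rewrite -eq kK in kH'.
  have [eqK|/eqP KK] := eqVneq K K'; first by apply: vy; apply: (or' v vp); rewrite -eqK.
  by have := oth' K (half_egraph hr) KH KK v vp; rewrite vK.
have nocr : {in x :: q &, forall v w, uadj v w -> ~~ crosses k [set v; w]}.
  by apply: in2W => v w; apply: uadj_not_crossed.
have nocr' : {in x' :: q' &, forall v w, uadj v w -> ~~ crosses k [set v; w]}.
  by apply: in2W => v w; apply: uadj_not_crossed.
have xu := walk_not_crossed uq1 nocr offq; have xu' := walk_not_crossed uq1' nocr' offq'.
have aA := hl_a hla; have aA' := hl_a hla'; have xA := hl_x hla; have xA' := hl_x hla'.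
have offu : u \notin k by rewrite -lq; apply: offq; apply: mem_last.
have := eg_opp facts kT kc aA (hl_a2 hla); rewrite -a'2.
rewrite (crosses_addb (offA _ aA) (offA _ xA) (offA' _ aA')).
rewrite (crosses_addb (offA _ xA) offu (offA' _ aA')).
rewrite (crosses_addb offu (offA' _ xA') (offA' _ aA')).
rewrite lq in xu; rewrite lq' setUC in xu'.
by rewrite (eg_same facts kT kc aA xA) (eg_same facts' kT kc' xA' aA') xu xu'.
Qed.

Lemma links_not_cross H A a x h K B b y k p H' A' a' x' h' K' B' b' y' k' p' :
  link H A a x h K B b y k p -> link H' A' a' x' h' K' B' b' y' k' p' ->
  crosses [set a; b] [set a'; b'] = false.
Proof.
move=> lk lk'; case cr: (crosses _ _) => //.
have [hl hr rp lst uq _ _ _ hk] := lk; have [hl' hr' rp' lst' uq' _ _ _ hk'] := lk'.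
have dis := crosses_disjoint cr.
have offa := disjointFr dis (set21 a b); have offb := disjointFr dis (set22 a b).
move: offa offb; rewrite !in_set2 => /norP[/eqP aa /eqP ab] /norP[/eqP ba /eqP bb].
have dAA := half_disjoint hl hl' aa; have dAB := half_disjoint hl hr' ab.
have dBA := half_disjoint hr hl' ba; have dBB := half_disjoint hr hr' bb.
have inA H0 A0 a0 x0 h0 : half H0 A0 a0 x0 h0 -> a0 \in A0 /\ x0 \in A0.
  by case=> c [A2 [a2 hla]]; split; [apply: hl_a hla | apply: hl_x hla].
have [aA xA] := inA _ _ _ _ _ hl; have [bB yB] := inA _ _ _ _ _ hr.
have [aA' xA'] := inA _ _ _ _ _ hl'; have [bB' yB'] := inA _ _ _ _ _ hr'.
have dis2 u v (E : {set 'I_n}) : u \notin E -> v \notin E -> [disjoint [set u; v] & E].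
  move=> uE vE; rewrite disjoint_subset; apply/subsetP => z.
  by rewrite in_set2 => /pred2P[]->; rewrite inE.
have offL z : z \in A -> z \notin [set a'; b'].
  by move=> zA; rewrite in_set2; apply/norP; split; apply/eqP=> eqz;
    [rewrite eqz (disjointFl dAA aA') in zA | rewrite eqz (disjointFl dAB bB') in zA].
have offR z : z \in B -> z \notin [set a'; b'].
  by move=> zB; rewrite in_set2; apply/norP; split; apply/eqP=> eqz;
    [rewrite eqz (disjointFl dBA aA') in zB | rewrite eqz (disjointFl dBB bB') in zB].
have offL' z : z \in A' -> z \notin [set x; y].
  by move=> zA; rewrite in_set2; apply/norP; split; apply/eqP=> eqz;
    [rewrite eqz (disjointFr dAA xA) in zA | rewrite eqz (disjointFr dBA yB) in zA].
have offR' z : z \in B' -> z \notin [set x; y].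
  by move=> zB; rewrite in_set2; apply/norP; split; apply/eqP=> eqz;
    [rewrite eqz (disjointFr dAB xA) in zB | rewrite eqz (disjointFr dBB yB) in zB].
(* Sliding a to x inside A and b to y inside B preserves the crossing, because a' and b' lie outside
   these arcs; [cr2] does the same for the other link. *)
have cr1 : crosses [set x; y] [set a'; b'].
  move: cr; rewrite crossesC (crosses_addb (offL _ aA) (offL _ xA) (offR _ bB)).
  rewrite (crosses_addb (offL _ xA) (offR _ yB) (offR _ bB)).
  rewrite (half_same hl _ aA xA) ?(half_same hr _ yB bB) ?addbF /=; last first.
  - by apply: dis2; rewrite ?(disjointFl dAA aA') ?(disjointFl dAB bB').
  - by apply: dis2; rewrite ?(disjointFl dBA aA') ?(disjointFl dBB bB').
  by rewrite crossesC.
have cr2 : crosses [set x; y] [set x'; y'].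
  move: cr1; rewrite (crosses_addb (offL' _ aA') (offL' _ xA') (offR' _ bB')).
  rewrite (crosses_addb (offL' _ xA') (offR' _ yB') (offR' _ bB')).
  rewrite (half_same hl' _ aA' xA') ?(half_same hr' _ yB' bB') ?addbF //=.
  - by apply: dis2; rewrite ?(disjointFr dAB xA) ?(disjointFr dBB yB).
  - by apply: dis2; rewrite ?(disjointFr dAA xA) ?(disjointFr dBA yB).
have [/hasP[u up up']|/hasPn nomeet] := boolP (has (mem (x' :: p')) (x :: p)); last first.
  (* Disjoint paths of uncrossed edges cannot have interlaced ends. *)
  have off v : v \in x :: p -> v \notin x' :: p' by apply: nomeet.
  have step : {in x :: p &, forall u v, uadj u v -> ~~ crosses [set x'; y'] [set u; v]}.
    move=> u v up vp uv; rewrite crossesC -lst'.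
    rewrite (walk_not_crossed rp') //.
      apply: in2W => u' v'; apply: uadj_not_crossed; by case/andP: uv.
    move=> z zp; rewrite in_set2; apply/norP; split; apply/eqP=> eqz.
      by move: (off _ up); rewrite -eqz zp.
    by move: (off _ vp); rewrite -eqz zp.
  have xy' : {in x :: p, forall z, z \notin [set x'; y']}.
    move=> z /off zp'; rewrite in_set2; apply: contra zp' => /pred2P[]->.
      exact: mem_head.
    by rewrite -lst'; apply: mem_last.
  have := walk_not_crossed rp step xy'; rewrite lst crossesC cr2 => absurd.
  by discriminate absurd.
(* Each link may be reversed, so [link_parallel_disjoint] applies to all four pairs formed by one of
   h, k and one of h', k'. Hence all four pairs cross, and together with [hk] and [hk'] they give
   four mutually crossing edges. *)
have [q [lkC eqq]] := link_sym lk; have [q' [lkC' eqq']] := link_sym lk'.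
have uq1 : u \in y :: q by rewrite eqq.
have uq1' : u \in y' :: q' by rewrite eqq'.
have [hH hT2 hT hcr ah] := half_rep hl; have [h'H h'T2 h'T h'cr ah'] := half_rep hl'.
have [kK kT2 kT kcr bk] := half_rep hr; have [k'K k'T2 k'T k'cr bk'] := half_rep hr'.
have [_ cross_or_par clique] := r2.
have [chh|chh] := boolP (crosses h h'); last first.
  by case: (link_parallel_disjoint lk lk' aa ab ba bb
    (cross_or_par h h' hT h'T hcr h'cr chh) up up').
have [chk|chk] := boolP (crosses h k'); last first.
  by case: (link_parallel_disjoint lk lkC' ab aa bb ba
    (cross_or_par h k' hT k'T hcr k'cr chk) up uq1').
have [ckh|ckh] := boolP (crosses k h'); last first.
  by case: (link_parallel_disjoint lkC lk' ba bb aa ab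
    (cross_or_par k h' kT h'T kcr h'cr ckh) uq1 up').
have [ckk|ckk] := boolP (crosses k k'); last first.
  by case: (link_parallel_disjoint lkC lkC' bb ba ab aa
    (cross_or_par k k' kT k'T kcr k'cr ckk) uq1 uq1').
by have := clique h k h' k' hT kT h'T k'T hk chh chk ckh ckk; rewrite hk'.
Qed.

Lemma link_of_new_edge e : new_edge T T2 e ->
  exists H A a x h K B b y k p, e = [set a; b] /\ link H A a x h K B b y k p.
Proof.
case=> H [A1 [A2 [K [B1 [B2 [x [p [a1 [a2 [b1 [b2]]]]]]]]]]].
case=> [[eH eK HK] [[aH aA1 aA2] [[bK bB1 bB2] [[isp onH onK oth] unc xA yB [ab eqe]]]]].
have [b factsH] := egraphP eH; have [c factsK] := egraphP eK.
move: aH bK; rewrite !in_setI => /andP[aH aT2] /andP[bK bT2].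
have /and3P[p0 uq ap] := isp.
have up : path uadj x p.
  elim: p x ap unc {p0 uq isp onH onK oth xA yB} => [//|y p IH] x /= /andP[xy yp] unc.
  apply/andP; split; first by apply/andP; split; [exact: xy | apply: unc; apply: mem_head].
  by apply: IH => // f fp; apply: unc; rewrite in_cons fp orbT.
have onlyH : {in x :: p, forall v, v \in cover H -> v = x}.
  by move=> v vp vH; apply: (proj1 (onH v)); split.
have onlyK : {in x :: p, forall v, v \in cover K -> v = last x p}.
  by move=> v vp vK; apply: (proj1 (onK v)); split.
(* An uncrossed edge with both ends in the arcs belongs to the e-graph. So a vertex outside
   [cover L] lies outside the arcs, and [eg_exit] applies to the step that enters them. *)
have exits (L : {set {set 'I_n}}) C1 C2 d u v : egraph_facts T L C1 C2 d -> uadj u v ->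
    u \notin cover L -> v \in C1 -> exists2 f, sim T d f & v \in f.
  move=> facts /andP[uvT uvunc] uL vC.
  apply: (eg_exit facts uvT uvunc); last by rewrite in_setU vC.
  apply: contra uL => uC; apply: (@mem_coverI L [set u; v]); last exact: set21.
  by apply: (eg_uncrossed facts uvT uvunc); rewrite subUset !sub1set uC in_setU vC.
have endx : exists2 f, sim T b f & x \in f.
  case: (p) p0 uq up onlyH => [//|y q] _ /andP[xq _] /andP[xy _] onlyy.
  apply: (exits _ _ _ _ y x factsH _ _ xA); first by rewrite uadj_sym.
  apply/negP=> yH; have yx : y = x by apply: (onlyy y) => //; rewrite !in_cons eqxx orbT.
  by rewrite yx mem_head in xq.
have endy : exists2 f, sim T c f & last x p \in f.
  have [q [y eqp]] : exists q y, p = rcons q y.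
    by case/lastP: (p) p0 => [//|q y _]; exists q, y.
  have onlyy := onlyK; rewrite eqp in up onlyy yB uq *.
  rewrite !last_rcons in onlyy yB *; rewrite rcons_path in up; case/andP: up => _ qy.
  apply: (exits _ _ _ _ _ _ factsK qy _ yB).
  have lin : last x q \in x :: rcons q y by rewrite -rcons_cons mem_rcons in_cons mem_last orbT.
  apply/negP=> /(onlyy _ lin) ly.
  by move: uq; rewrite -rcons_cons rcons_uniq -ly mem_last.
have hlH : half H A1 a1 x [set a1; a2] by exists b, A2, a2.
have hlK : half K B1 b1 (last x p) [set b1; b2] by exists c, B2, b2.
have [_ _ aT acr _] := half_rep hlH; have [_ _ bT bcr _] := half_rep hlK.
exists H, A1, a1, x, [set a1; a2], K, B1, b1, (last x p), [set b1; b2], p.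
split; first exact: eqe.
split=> //; have [//|ncr] := boolP (crosses [set a1; a2] [set b1; b2]).
have [_ cross_or_par _] := r2.
(* If the kept edges do not cross, they are parallel and the path joins them into one e-graph. The
   last vertex of the path is then in [cover H], so it equals x, against simplicity. *)
have par := cross_or_par _ _ aT bT acr bcr ncr.
have [f bf xf] := endx; have [g cg yg] := endy.
have simb : sim T b [set a1; a2] by rewrite -(eg_sim factsH) aH acr.
have simc : sim T c [set b1; b2] by rewrite -(eg_sim factsK) bK bcr.
have fg : parallel T f g.
  apply: parallel_trans (_ : parallel T f b) _.
    by rewrite parallelC; exact: (sim_parallel bf).
  apply: parallel_trans (sim_parallel simb) _; apply: parallel_trans par _.
  by apply: parallel_trans (sim_parallel cg); rewrite parallelC; exact: (sim_parallel simc).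
have sfg : sim T f g.
  apply: (simI fg xf yg).
  apply: (@connect_sub _ uadj) => [v w /andP[vT vunc]|]; last by apply/connectP; exists p.
  by apply: connect1; apply/andP; rewrite vunc.
have : sim T b g by exact: sim_trans bf sfg.
rewrite -(eg_sim factsH) => /andP[gH _].
have yx := onlyH _ (mem_last x p) (mem_coverI gH yg).
case: (p) p0 uq yx => [//|z q] _ /andP[xq _] yx.
by rewrite -yx /= mem_last in xq.
Qed.

Lemma rank_two_reduced T3 : step3 T T2 T3 -> rank_two T3.
Proof.
case=> _ eq3.
have sub : edges T2 \subset edges T3 by apply/subsetP=> e eT; apply/eq3; left.
have r22 : rank_two T2 by apply/(rank_two_kept st1 st2).
apply: rank_two_add sub _ r22 => e /eq3[eT2|enew] eN; first by rewrite eT2 in eN.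
have [H [A [a [x [h [K [B [b [y [k [p [-> lk]]]]]]]]]]]] := link_of_new_edge enew.
apply/negP=> /crossedP[f /eq3[fT2|fnew]].
  by rewrite crossesC (kept_not_crossed_link lk fT2).
have [H' [A' [a' [x' [h' [K' [B' [b' [y' [k' [p' [-> lk']]]]]]]]]]]] := link_of_new_edge fnew.
by rewrite (links_not_cross lk lk').
Qed.
End Links.

Lemma reduced_rank_two n (T T3 : cgraph n) : reduced_form T T3 -> rank_two T3 <-> rank_two T.
Proof.
case=> T1 [T2 [st1 st2 st3]]; split=> [r3|r2]; last exact: (rank_two_reduced st1 st2 r2 st3).
have [_ eq3] := st3.
have sub : edges T2 \subset edges T3 by apply/subsetP=> e eT; apply/eq3; left.
apply/(rank_two_kept st1 st2); apply: (rank_two_sub sub _ r3).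
(* The edge that crosses e in [T1] is itself crossed and so survives step 2 with e. *)
have crossed2 e : e \in edges T2 -> crossed T2 e.
  have [eq2 _] := st2; rewrite {1}eq2 inE => /andP[eT1 /crossedP[f fT1 ef]].
  apply/crossedP; exists f; last exact: ef.
  by rewrite eq2 inE fT1; apply/crossedP; exists e; rewrite // crossesC.
(* An added edge presupposes kept edges, so any edge of [T3] yields one of [T2]. *)
have [[e eT3 _] _ _] := r3.
suff [f fT2] : exists f, f \in edges T2 by exists f; [|apply: crossed2].
have [eT2|] := proj1 (eq3 e) eT3; first by exists e.
case=> H [A1 [A2 [K [B1 [B2 [x [p [a1 [a2 [b1 [b2]]]]]]]]]]].
by case=> [_ [[/setIP[_ aT2] _ _] _]]; exists [set a1; a2].
Qed.

(** * Genus and rank *)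

Section Points.
Variables (n : nat) (G : cgraph n).
Implicit Types (u v w : 'I_n) (e f : {set 'I_n}) (i j k : 'I_(npoints G)).

(** A lexicographic key: the vertex first, then its neighbours in the order v - 1, v - 2, ..., v +
    1. The factor n suffices since [ccw] stays below n. *)
Definition pkey (d : 'I_n * 'I_n) : nat := d.1 * n + ccw d.2 d.1.

Lemma ccw_lt u v : ccw u v < n.
Proof. by rewrite ltn_mod; case: (n) u => // -[]. Qed.

Lemma ltn_pkey u v u' v' : (pkey (u, v) < pkey (u', v')) =
  (u < u') || (u == u') && (ccw v u < ccw v' u').
Proof.
rewrite /pkey /= -val_eqE /=; have h1 := ccw_lt v u; have h2 := ccw_lt v' u'.
have [lt|lt|->] := ltngtP u u'; last by rewrite ltn_add2l.
  by apply: leq_trans (leq_addr _ _); have := leq_mul2r n u.+1 u'; rewrite lt orbT mulSn; lia.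
apply/negbTE; rewrite -leqNgt; have := leq_mul2r n u'.+1 u; rewrite lt orbT mulSn; lia.
Qed.

Lemma pairwise_enum_ord : pairwise (fun v w => v < w) (enum 'I_n).
Proof.
have := iota_ltn_sorted 0 n; rewrite (sorted_pairwise ltn_trans) -val_enum_ord.
by rewrite pairwise_map.
Qed.

(** The row reads v, ..., 0, n - 1, ..., v + 1; its two halves are the two cases of [ccwE]. *)
Lemma pairwise_row v :
  pairwise (fun w w' => ccw w v < ccw w' v) (rev (rot v.+1 (enum 'I_n))).
Proof.
have revP (s : seq 'I_n) (r : rel 'I_n) : pairwise r s -> pairwise (fun w w' => r w' w) (rev s).
  elim: s => //= w s IH /andP[ws /IH ps].
  rewrite rev_cons -cats1 pairwise_cat ps /= !andbT.
  rewrite allrel1r; apply/allP=> w'; rewrite mem_rev; exact: allP.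
have lo w : w \in take v.+1 (enum 'I_n) -> w <= v.
  move=> wt; have : val w \in take v.+1 (iota 0 n).
    by rewrite -val_enum_ord -map_take map_f.
  by rewrite take_iota mem_iota /=; lia.
have hi w : w \in drop v.+1 (enum 'I_n) -> v < w.
  move=> wt; have : val w \in drop v.+1 (iota 0 n).
    by rewrite -val_enum_ord -map_drop map_f.
  by rewrite drop_iota mem_iota /=; lia.
have := pairwise_enum_ord; rewrite -{1}(cat_take_drop v.+1 (enum 'I_n)) pairwise_cat.
case/and3P=> _ /revP p1 /revP p2; rewrite /rot rev_cat pairwise_cat.
have ccwlo w : w <= v -> ccw w v = v - w by move=> wv; rewrite ccwE wv.
have ccwhi w : v < w -> ccw w v = v + n - w by move=> wv; rewrite ccwE leqNgt wv.
apply/and3P; split.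
- apply/allrelP=> w w'; rewrite !mem_rev => /lo wv /hi vw.
  by rewrite ccwlo // ccwhi //; have := ltn_ord w'; lia.
- apply: (sub_in_pairwise _ (allss _)) p1 => w w'; rewrite !mem_rev => /lo wv /lo wv'.
  by rewrite !ccwlo //; lia.
- apply: (sub_in_pairwise _ (allss _)) p2 => w w'; rewrite !mem_rev => /hi wv /hi wv'.
  by rewrite !ccwhi //; have := ltn_ord w; have := ltn_ord w'; lia.
Qed.

Lemma points_sorted : pairwise (fun d d' => pkey d < pkey d') (points G).
Proof.
suff gen (s : seq 'I_n) : pairwise (fun v w => v < w) s ->
  pairwise (fun d d' => pkey d < pkey d')
    [seq (v, w) | v <- s, w <- [seq w <- rev (rot v.+1 (enum 'I_n)) | adj G v w]].
  exact: gen pairwise_enum_ord.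
elim: s => //= v s IH /andP[vs /IH ps].
rewrite pairwise_cat ps andbT; apply/andP; split.
  apply/allrelP=> _ _ /mapP[w _ ->] /allpairsPdep[v' [w' [v's _ ->]]].
  by rewrite ltn_pkey (allP vs).
rewrite pairwise_map; apply: pairwise_filter; have := pairwise_row v.
apply: sub_pairwise => w w' /=; by rewrite ltn_pkey eqxx => ->; rewrite orbT.
Qed.

Definition pt (i : 'I_(npoints G)) := tnth (in_tuple (points G)) i.
Definition ed (i : 'I_(npoints G)) : {set 'I_n} := [set (pt i).1; (pt i).2].

Lemma ltn_pt (i j : 'I_(npoints G)) : (i < j) = (pkey (pt i) < pkey (pt j)).
Proof.
have mono (i' j' : 'I_(npoints G)) : i' < j' -> pkey (pt i') < pkey (pt j').
  move=> ij; rewrite /pt; set d := tnth (in_tuple (points G)) i'.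
  rewrite /d !(tnth_nth d) /=.
  by apply: (pairwiseP d points_sorted); rewrite ?inE ?ltn_ord.
have [/mono|/mono|/val_inj->] := ltngtP i j => //; last by rewrite ltnn.
by move=> lt; apply/esym/negbTE; rewrite -leqNgt ltnW.
Qed.

Lemma pt_inj : injective pt.
Proof.
move=> i j eq; apply: val_inj; have := ltn_pt i j; have := ltn_pt j i; rewrite eq ltnn.
by case: ltngtP.
Qed.

Lemma pt_alpha i : pt (alpha_fun i) = ((pt i).2, (pt i).1).
Proof.
rewrite {1}/pt (tnth_nth (pt i)) /= nth_index //.
by rewrite swap_points mem_tnth.
Qed.

Lemma ed_edge i : ed i \in edges G.
Proof. by have : pt i \in points G by [apply: mem_tnth]; rewrite mem_points. Qed.

Lemma ed_alpha i : ed (alpha_fun i) = ed i.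
Proof. by rewrite /ed pt_alpha /= setUC. Qed.

Lemma ed_eq i j : ed i = ed j -> i = j \/ i = alpha_fun j.
Proof.
case/set2_eq=> -[eq1 eq2]; [left | right]; apply: pt_inj; rewrite ?pt_alpha.
  by rewrite [LHS]surjective_pairing eq1 eq2 -surjective_pairing.
by rewrite [LHS]surjective_pairing eq1 eq2.
Qed.

Lemma ed_eqE i j : (ed i == ed j) = (i == j) || (i == alpha_fun j).
Proof.
apply/eqP/orP => [/ed_eq[]->|[]/eqP->]; rewrite ?eqxx ?ed_alpha //; by [left|right].
Qed.

Lemma alpha_neq i : alpha_fun i != i.
Proof.
apply/eqP=> eq; have := pt_alpha i; rewrite eq => /(congr1 fst) /= eq12.
by have := edge_neq (ed_edge i); rewrite /ed eq12 eqxx.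
Qed.

Lemma ed_surj e : e \in edges G -> exists i, ed i = e.
Proof.
move=> eG; have [u [v [_ eqe]]] := edge_pair eG.
have : (u, v) \in points G by rewrite mem_points /adj /= -eqe.
rewrite -[points G]/(val (in_tuple (points G))) => /tnthP[i eqi].
by exists i; rewrite /ed /pt -eqi eqe.
Qed.

Definition btw (i k : 'I_(npoints G)) : bool :=
  minn i (alpha_fun i) < k < maxn i (alpha_fun i).

(** Splitting vertices preserves crossings. The delicate case is a common vertex, where the order of
    the points at that vertex keeps the two edges apart. *)
Lemma btw_crosses i j : ed i != ed j ->
  crosses (ed i) (ed j) = btw i j (+) btw i (alpha_fun j).
Proof.
have inb (k l m : 'I_(npoints G)) : (minn k l < m < maxn k l) =
    (k < m) && (m < l) || (l < m) && (m < k).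
  by rewrite gtn_min leq_max; lia.
rewrite /btw !inb !ltn_pt !pt_alpha /ed.
have := edge_neq (ed_edge i); have := edge_neq (ed_edge j).
case: (pt i) => v w; case: (pt j) => c d /=; rewrite !ltn_pkey.
move=> cd vw; rewrite crossesE !inE => neq.
have neq1 : ~~ ((v == c) && (w == d)) by apply: contra neq => /andP[/eqP-> /eqP->].
have neq2 : ~~ ((v == d) && (w == c)) by apply: contra neq => /andP[/eqP-> /eqP->]; rewrite setUC.
clear neq; move: cd vw neq1 neq2; rewrite /inside -!val_eqE /= !ccwE.
have := ltn_ord c; have := ltn_ord d; have := ltn_ord v; have := ltn_ord w.
have [|] := eqVneq (val c) (val v); have [|] := eqVneq (val c) (val w);
have [|] := eqVneq (val d) (val v); have [|] := eqVneq (val d) (val w);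
  rewrite /=; do ?[case: ifPn]; lia.
Qed.
End Points.

Local Opaque alpha_fun.

(** * Cycle counts and colourings of the circle *)

Lemma card_imset_eq (aT rT rT' : finType) (f : aT -> rT) (g : aT -> rT') :
  (forall i j, (f i == f j) = (g i == g j)) -> #|[set f i | i : aT]| = #|[set g i | i : aT]|.
Proof.
move=> fg; pose h y := omap g [pick i | f i == y].
have hf i : h (f i) = Some (g i).
  rewrite /h; case: pickP => [j|/(_ i)]; last by rewrite eqxx.
  by rewrite fg => /eqP /= ->.
have inj : {in [set f i | i : aT] &, injective h}.
  move=> _ _ /imsetP[i _ ->] /imsetP[j _ ->]; rewrite !hf => -[/eqP].
  by rewrite -fg => /eqP.
rewrite -(card_in_imset inj) -(card_imset [set g i | i : aT] (@Some_inj _)).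
by congr #|pred_of_set _|; rewrite -!imset_comp; apply: eq_imset => i /=; rewrite hf.
Qed.

(** Invariant sets are the unions of orbits, and [cover] is injective on sets of orbits. *)
Lemma card_perm_invariant (X : finType) (s : {perm X}) :
  #|[set B : {set X} | [forall x, (s x \in B) == (x \in B)]]| = 2 ^ ncycles s.
Proof.
rewrite /ncycles -card_powerset.
have inj : {in powerset (porbits s) &, injective (@cover X)}.
  suff sub (P Q : {set {set X}}) : P \subset porbits s -> Q \subset porbits s ->
      cover P = cover Q -> P \subset Q.
    move=> P Q; rewrite !inE => sP sQ eqc; apply/eqP.
    by rewrite eqEsubset; apply/andP; split; apply: sub.
  move=> /subsetP sP /subsetP sQ eqc; apply/subsetP => C CP.
  have /imsetP[x _ eqC] := sP C CP.
  have : x \in cover Q by rewrite -eqc; apply/bigcupP; exists C; rewrite // eqC porbit_id.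
  case/bigcupP=> C' C'Q xC'; have /imsetP[y _ eqC'] := sQ C' C'Q.
  have /eqP eqxy : porbit s x == porbit s y by rewrite eq_porbit_mem -eqC'.
  by rewrite eqC eqxy -eqC'.
rewrite -(card_in_imset inj); apply: eq_card => B; rewrite inE.
apply/forallP/imsetP => [inv|[Q]].
  have invX k x : ((s ^+ k)%g x \in B) = (x \in B).
    elim: k => [|k IH]; first by rewrite expg0 perm1.
    by rewrite expgSr permM (eqP (inv _)) IH.
  exists [set porbit s x | x in B].
    by rewrite inE; apply/subsetP=> _ /imsetP[x _ ->]; apply: imset_f.
  apply/setP=> x; apply/idP/bigcupP => [xB|[_ /imsetP[y yB ->]]].
    by exists (porbit s x); [apply: imset_f | apply: porbit_id].
  by case/porbitP=> k ->; rewrite invX.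
rewrite inE => /subsetP sQ -> x.
have step C : C \in Q -> (s x \in C) = (x \in C).
  move=> /sQ/imsetP[y _ ->]; rewrite -!eq_porbit_mem.
  by have := porbit_perm s 1 x; rewrite expg1 => ->.
by apply/eqP; apply/bigcupP/bigcupP => -[C CQ xC]; exists C; rewrite // ?step // -step.
Qed.

Section Boundary.
Variables (n : nat) (G : cgraph n).
Local Notation N := (npoints G).
Implicit Types (e f : {set 'I_n}) (i j k : 'I_N) (S : {set {set 'I_n}}) (b : bool).

Definition cross_parity S e : bool := \big[addb/false]_(f in S) crosses e f.

(** The kernel of the crossing matrix, its F_2-vectors written as edge sets. *)
Definition cross_kernel : {set {set {set 'I_n}}} :=
  [set S : {set {set 'I_n}} | (S \subset edges G) && [forall e in edges G, ~~ cross_parity S e]].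

Definition jumps S (m : nat) : bool := \big[addb/false]_(k < N | k < m) (ed k \in S).

Lemma jumps0 S : jumps S 0 = false.
Proof. by rewrite /jumps big_pred0. Qed.

Lemma jumpsS S i : jumps S i.+1 = jumps S i (+) (ed i \in S).
Proof.
rewrite /jumps (bigD1 i) //= addbC; congr (_ (+) _); apply: eq_bigl => k.
by rewrite ltnS ltn_neqAle andbC.
Qed.

(** Each edge contributes both its points, so a colouring closes up after one turn. *)
Lemma jumpsN S : jumps S N = false.
Proof.
rewrite /jumps (bigID (fun k : 'I_N => k < alpha_fun k)) /=.
rewrite [X in _ (+) X](reindex_inj (inv_inj (@alpha_funK n G))) /=.
rewrite [X in _ (+) X](eq_big (fun k : 'I_N => (k < N) && (k < alpha_fun k))
                              (fun k => ed k \in S)).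
- exact: addbb.
- move=> k. rewrite !ltn_ord alpha_funK /= -leqNgt leq_eqVlt.
  by have /negbTE := alpha_neq k; rewrite -val_eqE /= eq_sym => ->.
- by move=> k _; rewrite ed_alpha.
Qed.

(** An edge f other than [ed i] has an odd number of its two points between those of [ed i] exactly
    when it crosses [ed i]; the edge [ed i] itself has none there. *)
Lemma btw_parity S i : S \subset edges G ->
  \big[addb/false]_(k | btw i k) (ed k \in S) = cross_parity S (ed i).
Proof.
move=> /subsetP sub; rewrite /cross_parity.
transitivity (\big[addb/false]_(f in S) \big[addb/false]_(k | ed k == f) btw i k).
  rewrite (eq_bigr (fun f => \big[addb/false]_k (if ed k == f then btw i k else false)));
    last first.
    by move=> f _; rewrite big_mkcond.
  rewrite exchange_big /= big_mkcond; apply: eq_bigr => k _.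
  have [kS|kS] := boolP (ed k \in S).
    rewrite (bigD1 (ed k)) //= eqxx big1 ?addbF //; first by case: (btw i k).
    by move=> f /andP[_ /negbTE]; rewrite eq_sym => ->.
  rewrite big1; first by rewrite if_same.
  by move=> f fS; case: eqP => // eqf; rewrite eqf fS in kS.
apply: eq_bigr => f /sub fG; have [j eqj] := ed_surj fG.
have pr k : (ed k == f) = (k == j) || (k == alpha_fun j) by rewrite -eqj ed_eqE.
rewrite (eq_bigl _ _ pr) (bigD1 j) ?eqxx //= (bigD1 (alpha_fun j)) ?eqxx ?orbT ?alpha_neq //=.
rewrite big1 ?addbF; last by move=> k; case: (k == j); case: (k == alpha_fun j).
have [eqe|neq] := eqVneq (ed i) (ed j); last by rewrite -eqj btw_crosses.
rewrite -eqj eqe crossesxx.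
have nb k : ed i = ed k -> btw i k = false.
  case/ed_eq=> [->|->]; rewrite /btw ?alpha_funK ?gtn_min ?leq_max ?ltnn ?orbF ?orFb;
    by case: ltngtP.
by rewrite !nb ?ed_alpha.
Qed.

(** Between i and its partner the colour changes at the nearer point and at the points strictly
    between. The equation is symmetric in i and [alpha_fun i], so one order suffices. *)
Lemma jumps_alpha S i : S \subset edges G ->
  jumps S (alpha_fun i) = jumps S i (+) (ed i \in S) (+) cross_parity S (ed i).
Proof.
move=> sub.
have step k : k < alpha_fun k ->
    jumps S (alpha_fun k) = jumps S k (+) (ed k \in S) (+) cross_parity S (ed k).
  move=> lt; rewrite -jumpsS -(btw_parity _ sub) /jumps.
  rewrite (bigID (fun j : 'I_N => j < k.+1)) /=; congr (_ (+) _); apply: eq_bigl => j.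
    by rewrite andb_idl // => jk; apply: leq_trans jk _.
  by rewrite /btw -leqNgt (minn_idPl (ltnW lt)) (maxn_idPr (ltnW lt)) andbC.
have [/step//|lt|/val_inj eq] := ltngtP i (alpha_fun i); last first.
  by have := alpha_neq i; rewrite -eq eqxx.
have := step (alpha_fun i); rewrite alpha_funK => /(_ lt) ->.
rewrite ed_alpha.
by move: (jumps _ _) (ed i \in S) (cross_parity _ _) => [] [] [].
Qed.

(* Colours the arc that ends at point i; the colour changes at the points of
   the edges in S. *)
Definition coloring b S : {set 'I_N} := [set i : 'I_N | b (+) jumps S i].

Lemma coloring_sigma b S i :
  (sigma G i \in coloring b S) = (i \in coloring b S) (+) (ed i \in S).
Proof.
rewrite !inE permE -addbA -jumpsS /ordS /=; congr (_ (+) _).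
have := ltn_ord i; rewrite leq_eqVlt => /predU1P[eqN|lt]; last by rewrite modn_small.
by rewrite eqN modnn jumps0 jumpsN.
Qed.

(** Invariance under the product of the inverse of [alpha] with [sigma], evaluated at [alpha_fun i]
    to remove the inverse. *)
Definition invariant_sets : {set {set 'I_N}} :=
  [set B : {set 'I_N} | [forall i, (sigma G i \in B) == (alpha_fun i \in B)]].

Lemma coloring_invariant b S : S \subset edges G ->
  (coloring b S \in invariant_sets) = (S \in cross_kernel).
Proof.
move=> sub; rewrite !inE sub /=.
have step i : (sigma G i \in coloring b S) == (alpha_fun i \in coloring b S) =
    ~~ cross_parity S (ed i).
  rewrite coloring_sigma !inE jumps_alpha //.
  by move: (jumps _ _) (ed i \in S) (cross_parity _ _) => [] [] []; case: b.
apply/forallP/forall_inP => [inv e eG|ker i].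
  by have [i <-] := ed_surj eG; rewrite -step inv.
by rewrite step ker ?ed_edge.
Qed.

(** An invariant set is determined by the colour of point 0 and the set of edges where the colour
    changes; the factor 2 counts the former. An edge guarantees that point 0 exists. *)
Lemma card_invariant_sets : edges G != set0 -> #|invariant_sets| = 2 * #|cross_kernel|.
Proof.
case/set0Pn=> e0 e0G; have [i0 _] := ed_surj e0G.
have N0 : 0 < N := leq_ltn_trans (leq0n i0) (ltn_ord i0).
pose z : 'I_N := Ordinal N0; have z0 S : jumps S z = false by apply: jumps0.
pose F (bS : bool * {set {set 'I_n}}) := coloring bS.1 bS.2.
have inj : {in setX setT cross_kernel &, injective F}.
  move=> [b S] [b' S']; rewrite !inE /= => /andP[/subsetP sS _] /andP[/subsetP sS' _].
  rewrite /F /= => eqc; have eqb : b = b'.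
    by have := congr1 (fun B : {set _} => z \in B) eqc; rewrite !inE !z0 !addbF.
  have eqS i : (ed i \in S) = (ed i \in S').
    by have := coloring_sigma b S i; rewrite eqc coloring_sigma => /addbI.
  congr (_, _) => //; apply/setP => e; apply/idP/idP => eS.
    by have [i eqi] := ed_surj (sS e eS); rewrite -eqi -eqS eqi.
  by have [i eqi] := ed_surj (sS' e eS); rewrite -eqi eqS eqi.
have <- : #|setX [set: bool] cross_kernel| = 2 * #|cross_kernel|.
  by rewrite cardsX cardsT card_bool.
rewrite -(card_in_imset inj); apply: eq_card => B; apply/idP/imsetP => [inv|[[b S]]]; last first.
  rewrite in_setX => /andP[_ /= SK ->]; rewrite coloring_invariant //.
  by move: SK; rewrite inE => /andP[].
have invB i : (sigma G i \in B) = (alpha_fun i \in B).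
  by move: inv; rewrite inE => /forallP/(_ i)/eqP.
(* By invariance [sigma G i] has the colour of [alpha_fun i], so this condition says that the colour
   changes at i. It is symmetric in i and [alpha_fun i], hence a property of the edge. *)
pose S : {set {set 'I_n}} := [set ed i | i : 'I_N & (i \in B) (+) (alpha_fun i \in B)].
have edS i : (ed i \in S) = (i \in B) (+) (alpha_fun i \in B).
  apply/imsetP/idP => [[j]|]; last by move=> h; exists i; rewrite ?inE.
  rewrite inE => jB /ed_eq[->|->]; rewrite ?alpha_funK; move: jB;
  by do 2!case: (_ \in B).
have eqB : B = coloring (z \in B) S.
  apply/setP; suff col m (lt : m < N) : (Ordinal lt \in B) = (Ordinal lt \in coloring (z \in B) S).
    by case.
  elim: m lt => [|m IH] lt; first by rewrite inE jumps0 addbF; congr (_ \in B); apply: val_inj.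
  have -> : Ordinal lt = sigma G (Ordinal (ltnW lt)).
    by apply: val_inj; rewrite permE /= modn_small.
  rewrite coloring_sigma -IH edS addKb; exact: invB.
exists (z \in B, S) => //.
rewrite in_setX in_setT -(coloring_invariant (z \in B)) -?eqB ?inv //.
by apply/subsetP=> _ /imsetP[i _ ->]; apply: ed_edge.
Qed.

Lemma face_count : edges G != set0 ->
  2 ^ ncycles ((alpha G)^-1 * sigma G)%g = 2 * #|cross_kernel|.
Proof.
move=> G0; rewrite -card_invariant_sets // -card_perm_invariant.
apply: eq_card => B; rewrite !inE.
have alphaE i : alpha G i = alpha_fun i by rewrite permE.
apply/forallP/forallP => inv i.
  by have := inv (alpha G i); rewrite permM permK alphaE.
rewrite permM; have := inv ((alpha G)^-1 i)%g; by rewrite -alphaE permKV.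
Qed.

Lemma card_points : N = #|edges G| * 2.
Proof.
transitivity (\sum_(i : 'I_N) 1)%N; first by rewrite sum1_card card_ord.
rewrite (partition_big (@ed n G) (mem (edges G))) => [|i _]; last exact: ed_edge.
rewrite -sum_nat_const; apply: eq_bigr => e eG; have [i <-] := ed_surj eG.
rewrite sum1_card -[RHS]/((~~ false).+1) -(negbTE (alpha_neq i)) eq_sym -card2.
apply: eq_card => k; transitivity (ed k == ed i); first by [].
by rewrite ed_eqE !inE.
Qed.

Lemma ncycles_alpha : ncycles (alpha G) = #|edges G|.
Proof.
have step m y : ((alpha G ^+ m)%g y == y) || ((alpha G ^+ m)%g y == alpha_fun y).
  elim: m => [|m IH]; first by rewrite expg0 perm1 eqxx.
  rewrite expgSr permM permE; case/orP: IH => /eqP->; first by rewrite eqxx orbT.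
  by rewrite alpha_funK eqxx.
have orbE i j : (porbit (alpha G) i == porbit (alpha G) j) = (ed i == ed j).
  rewrite eq_porbit_mem ed_eqE; apply/porbitP/orP => [[k ->]|[]/eqP->].
  - by apply/orP; apply: step.
  - by exists 0; rewrite expg0 perm1.
  - by exists 1; rewrite expg1 permE.
have -> : edges G = [set ed i | i : 'I_N].
  apply/setP=> e; apply/idP/imsetP => [/ed_surj[i <-]|[i _ ->]]; last exact: ed_edge.
  by exists i.
exact: card_imset_eq orbE.
Qed.

End Boundary.

Import GRing.Theory.

(** * The crossing matrix over F_2 *)

Lemma F2_cases (x : 'F_2) : x = 0%R \/ x = 1%R.
Proof. by case: x => [[|[|[]]] //= lt]; [left | right]; apply: val_inj. Qed.

Lemma natr_addb (b c : bool) : ((b (+) c)%:R = b%:R + c%:R :> 'F_2)%R.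
Proof. by case: b; case: c; apply: val_inj. Qed.

Lemma natr_F2_inj (b c : bool) : (b%:R = c%:R :> 'F_2)%R -> b = c.
Proof. by case: b; case: c => // /eqP. Qed.

Lemma addvv_F2 m (u : 'rV['F_2]_m) : (u + u = 0)%R.
Proof. by apply/rowP=> j; rewrite !mxE; case: (F2_cases (u 0%R j)) => ->; apply: val_inj. Qed.

(** The span of u and v, listed so that its dimension can be read off from its cardinality. *)
Definition plane (d : nat) (u v : 'rV['F_2]_d) : {set 'rV['F_2]_d} :=
  [set w in [:: 0; u; v; u + v]]%R.

Lemma card_plane d (u v : 'rV['F_2]_d) : u != 0%R -> v != 0%R -> u != v -> #|plane u v| = 4.
Proof.
move=> u0 v0 uv; rewrite /plane cardsE; suff /card_uniqP-> : uniq [:: 0; u; v; u + v]%R by [].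
rewrite /=.
rewrite !inE !negb_or ![(0%R == _)]eq_sym u0 v0 uv /= andbT.
have add0 (w z : 'rV['F_2]_d) : (w + z == 0)%R = (w == z).
  by rewrite -(inj_eq (addIr z)) -addrA addvv_F2 addr0 add0r.
rewrite add0 uv /= -{1}[u]addr0 (inj_eq (addrI u)) [(0%R == v)]eq_sym v0 /=.
by rewrite -{1}[v]add0r (inj_eq (addIr v)) eq_sym u0.
Qed.

Lemma planeP d (u v w : 'rV['F_2]_d) :
  (exists a b : 'F_2, w = a *: u + b *: v)%R <-> w \in plane u v.
Proof.
rewrite !inE; split=> [[a [b ->]]|].
  by case: (F2_cases a) => ->; case: (F2_cases b) => ->;
    rewrite !(scale0r, scale1r, addr0, add0r) eqxx ?orbT.
case/or4P=> /eqP->; [exists 0%R, 0%R | exists 1%R, 0%R | exists 0%R, 1%R | exists 1%R, 1%R];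
  by rewrite !(scale0r, scale1r, addr0, add0r).
Qed.

Section CrossingMatrix.
Variables (n : nat) (G : cgraph n).
Local Notation m := #|edges G|.
Implicit Types (e f : {set 'I_n}) (i j k : 'I_m) (S : {set {set 'I_n}}).
Local Notation E := (@enum_val _ (mem (edges G))).

Definition crossing_mx : 'M['F_2]_m := (\matrix_(i, j) (crosses (E i) (E j))%:R)%R.

Definition indicator S : 'rV['F_2]_m := (\row_j (E j \in S)%:R)%R.

Lemma E_surj e : e \in edges G -> exists i, E i = e.
Proof. by move=> eG; exists (enum_rank_in eG e); rewrite enum_rankK_in. Qed.

Lemma indicator_mul S : S \subset edges G ->
  (indicator S *m crossing_mx = \row_j (cross_parity S (E j))%:R)%R.
Proof.
move=> /subsetP sub; apply/rowP=> j; rewrite !mxE.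
rewrite /cross_parity (big_morph (fun b : bool => b%:R : 'F_2)%R natr_addb (erefl _)).
transitivity (\sum_(f in edges G) (f \in S)%:R * (crosses (E j) f)%:R : 'F_2)%R.
  by rewrite (big_enum_val (fun f => (f \in S)%:R * (crosses (E j) f)%:R)%R);
    apply: eq_bigr => k _; rewrite !mxE crossesC.
rewrite big_mkcond [RHS]big_mkcond; apply: eq_bigr => f _.
have [/sub->|fS] := boolP (f \in S); first by rewrite mul1r.
by rewrite mul0r if_same.
Qed.

(** [indicator] identifies [cross_kernel G] with the left kernel of the matrix. *)
Lemma card_cross_kernel : #|cross_kernel G| = 2 ^ (m - \rank crossing_mx).
Proof.
have inj : {in cross_kernel G &, injective indicator}.
  move=> S S'; rewrite !inE => /andP[/subsetP sS _] /andP[/subsetP sS' _] /rowP eqS.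
  have eqE i : (E i \in S) = (E i \in S').
    by apply: natr_F2_inj; have := eqS i; rewrite !mxE.
  apply/setP=> e; apply/idP/idP => eS.
    by have [i eqi] := E_surj (sS e eS); rewrite -eqi -eqE eqi.
  by have [i eqi] := E_surj (sS' e eS); rewrite -eqi eqE eqi.
transitivity #|rowg (kermx crossing_mx)|; last by rewrite card_rowg mxrank_ker card_Fp.
rewrite -(card_in_imset inj); apply: eq_card => u.
rewrite [RHS]inE; apply/imsetP/sub_kermxP => [[S SK ->]|uM].
  move: SK; rewrite inE => /andP[sub /forall_inP ker]; rewrite indicator_mul //.
  by apply/rowP=> j; rewrite !mxE (negbTE (ker _ (enum_valP j))).
pose S : {set {set 'I_n}} := [set E i | i : 'I_m & u 0%R i != 0%R].
have sub : S \subset edges G by apply/subsetP=> _ /imsetP[i _ ->]; apply: enum_valP.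
have eqS : indicator S = u.
  apply/rowP=> i; rewrite mxE mem_imset ?inE; last exact: enum_val_inj.
  by case: (F2_cases (u 0%R i)) => ->.
exists S; last by rewrite eqS.
rewrite inE sub; apply/forall_inP => e /E_surj[i <-].
move: uM; rewrite -eqS indicator_mul // => /rowP/(_ i); rewrite !mxE.
by case: (cross_parity _ _).
Qed.

Lemma crossing_row i j : row i crossing_mx 0%R j = (crosses (E i) (E j))%:R%R.
Proof. by rewrite !mxE. Qed.

Lemma row0P i : reflect (row i crossing_mx = 0%R) (~~ crossed G (E i)).
Proof.
apply: (iffP idP) => [unc|row0].
  apply/rowP=> j; rewrite crossing_row mxE crossesC.
  by rewrite (uncrossedP unc (enum_valP j)).
apply/negP=> /crossedP[f /E_surj[j <-] cr].
by have := congr1 (fun u : 'rV__ => u 0%R j) row0; rewrite crossing_row mxE cr.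
Qed.

Lemma row_eqP i j : reflect (row i crossing_mx = row j crossing_mx) (parallel G (E i) (E j)).
Proof.
apply: (iffP (parallelP _ _ _)) => [[_ _ par]|eqr].
  by apply/rowP=> k; rewrite !crossing_row (par _ (enum_valP k)).
split; [exact: enum_valP | exact: enum_valP | move=> g /E_surj[k <-]].
apply: natr_F2_inj; have := congr1 (fun u : 'rV__ => u 0%R k) eqr.
by rewrite !crossing_row.
Qed.

Lemma rank2E : (\rank crossing_mx == 2) = (#|rowg crossing_mx| == 4).
Proof. by rewrite card_rowg card_Fp // -[4]/(2 ^ 2) eqn_exp2l. Qed.

(** Two crossing edges i and j have independent rows. An uncrossed k has row zero, a crossed k
    missing i or j is parallel to it and has the same row, and a k crossing both has the sum of the
    two rows. Conversely, two crossed edges that are not parallel have rows spanning the row space,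
    and single entries of a third row decide the conditions. *)
Lemma rank_twoP : rank_two G <-> \rank crossing_mx = 2.
Proof.
split=> [[[e0 e0G e0cr] par clique]|/eqP].
  have [f0 f0G cr0] := crossedP _ _ e0cr.
  have [i eqi] := E_surj e0G; have [j eqj] := E_surj f0G.
  rewrite -eqi -eqj in cr0.
  apply/eqP; rewrite rank2E.
  have icr : crossed G (E i) by rewrite eqi.
  have jcr : crossed G (E j) by apply/crossedP; exists (E i); [exact: enum_valP | rewrite crossesC].
  have neq : row i crossing_mx != row j crossing_mx.
    by apply/eqP => /row_eqP/parallel_not_crossed; rewrite cr0.
  have i0 : row i crossing_mx != 0%R by apply/eqP => /row0P; rewrite icr.
  have j0 : row j crossing_mx != 0%R by apply/eqP => /row0P; rewrite jcr.
  rewrite -(card_plane i0 j0 neq); apply/eqP/eq_card => u.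
  have rowP k : row k crossing_mx \in plane (row i crossing_mx) (row j crossing_mx).
    have [kcr|/row0P->] := boolP (crossed G (E k)); last by rewrite !inE eqxx.
    have cross_or l : crossed G (E l) -> crosses (E i) (E l) \/ parallel G (E i) (E l).
      move=> lcr; have [|ncr] := boolP (crosses (E i) (E l)); [by left | right].
      exact: par (enum_valP i) (enum_valP l) icr lcr ncr.
    have cross_or' l : crossed G (E l) -> crosses (E j) (E l) \/ parallel G (E j) (E l).
      move=> lcr; have [|ncr] := boolP (crosses (E j) (E l)); [by left | right].
      exact: par (enum_valP j) (enum_valP l) jcr lcr ncr.
    have [ik|/row_eqP <-] := cross_or k kcr; last by rewrite !inE eqxx orbT.
    have [jk|/row_eqP <-] := cross_or' k kcr; last by rewrite !inE eqxx !orbT.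
    (* At column l: an l crossing both i and j cannot cross k, by [clique]; an l parallel to i or j
       has the same crossings as that edge. *)
    suff -> : row k crossing_mx = (row i crossing_mx + row j crossing_mx)%R.
      by rewrite !inE eqxx !orbT.
    apply/rowP=> l; rewrite crossing_row [in RHS]mxE !crossing_row -natr_addb.
    congr ((nat_of_bool _)%:R)%R.
    have [lcr|lunc] := boolP (crossed G (E l)); last first.
      by rewrite !(uncrossedP lunc (enum_valP _)).
    have [il|ilp] := cross_or l lcr; last first.
      have /parallelP[_ _ pil] := ilp.
      rewrite (parallel_not_crossed ilp) [crosses (E k) _]crossesC [crosses (E j) _]crossesC.
      by rewrite -(pil _ (enum_valP k)) -(pil _ (enum_valP j)) ik cr0.
    have [jl|jlp] := cross_or' l lcr; last first.
      have /parallelP[_ _ pjl] := jlp.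
      rewrite (parallel_not_crossed jlp) [crosses (E k) _]crossesC [crosses (E i) (E l)]crossesC.
      by rewrite -(pjl _ (enum_valP k)) -(pjl _ (enum_valP i)) jk crossesC cr0.
    rewrite il jl addbb; apply: negbTE.
    exact: (clique _ _ _ _ (enum_valP i) (enum_valP j) (enum_valP k) (enum_valP l)
              cr0 ik il jk jl).
  rewrite inE; apply/idP/idP => [/submxP[D ->]|/planeP[a [b ->]]]; last first.
    by rewrite addmx_sub ?scalemx_sub ?row_sub.
  rewrite mulmx_sum_row; elim/big_rec: _ => [|k w _ /planeP[a [b ->]]].
    by rewrite !inE eqxx.
  have /planeP[c [d ->]] := rowP k; apply/planeP.
  exists (D 0 k * c + a)%R, (D 0 k * d + b)%R.
  by rewrite scalerDr !scalerA !scalerDl addrACA.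
rewrite rank2E => /eqP card4.
have span i j k : crossed G (E i) -> crossed G (E j) -> ~~ parallel G (E i) (E j) ->
    exists a b : 'F_2, (row k crossing_mx = a *: row i crossing_mx + b *: row j crossing_mx)%R.
  move=> icr jcr npar; apply/planeP.
  have i0 : row i crossing_mx != 0%R by apply/eqP => /row0P; rewrite icr.
  have j0 : row j crossing_mx != 0%R by apply/eqP => /row0P; rewrite jcr.
  have ij : row i crossing_mx != row j crossing_mx by apply/eqP => /row_eqP; rewrite (negbTE npar).
  suff -> : plane (row i crossing_mx) (row j crossing_mx) = rowg crossing_mx.
    by rewrite inE row_sub.
  apply/eqP; rewrite eqEcard card4 (card_plane i0 j0 ij) leqnn andbT.
  apply/subsetP=> u /planeP[a [b ->]].
  by rewrite inE addmx_sub ?scalemx_sub ?row_sub.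
have entry k l i j (a b : 'F_2) :
    (row k crossing_mx = a *: row i crossing_mx + b *: row j crossing_mx)%R ->
    ((crosses (E k) (E l))%:R =
     a * (crosses (E i) (E l))%:R + b * (crosses (E j) (E l))%:R :> 'F_2)%R.
  by move=> /rowP/(_ l); rewrite !mxE.
split.
- have [/existsP[i icr]|none] := boolP [exists i : 'I_m, crossed G (E i)].
    by exists (E i); first exact: enum_valP.
  move: card4; suff -> : crossing_mx = 0%R by rewrite card_rowg mxrank0.
  apply/row_matrixP => i; rewrite row0; apply/row0P.
  by apply: contra none => icr; apply/existsP; exists i.
- move=> e f /E_surj[i <-] /E_surj[j <-] icr jcr ij.
  have [//|npar] := boolP (parallel G (E i) (E j)).
  have [f' /E_surj[k <-] ik] := crossedP _ _ icr.
  have [a [b eqk]] := span i j k icr jcr npar.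
  (* At column i the rows of i and j are both 0, while k crosses i. *)
  have := entry k i i j a b eqk; rewrite crossesxx [crosses (E j) _]crossesC (negbTE ij) crossesC ik.
  by rewrite !mulr0 addr0.
- move=> e f g h /E_surj[i <-] /E_surj[j <-] /E_surj[k <-] /E_surj[l <-] ij ik il jk jl.
  apply/negP=> kl.
  have icr : crossed G (E i) by apply/crossedP; exists (E j); first exact: enum_valP.
  have jcr : crossed G (E j) by apply/crossedP; exists (E k); first exact: enum_valP.
  have npar : ~~ parallel G (E i) (E j) by apply/negP => /parallel_not_crossed; rewrite ij.
  have [a [b eqk]] := span i j k icr jcr npar.
  (* Columns i and j give b = 1 and a = 1; column l then reads 1 = 1 + 1. *)
  have := entry k i i j a b eqk; rewrite crossesxx crossesC ik crossesC ij mulr0 add0r mulr1 => b1.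
  have := entry k j i j a b eqk; rewrite crossesxx crossesC jk ij mulr0 addr0 mulr1 => a1.
  by have := entry k l i j a b eqk; rewrite kl il jl -a1 -b1 !mulr1.
Qed.

End CrossingMatrix.

(** With m >= 1 edges and rank r there are 2m points, m cycles of [alpha] and m - r + 1 faces, so
    the genus formula gives r / 2. Without edges the matrix is empty and has rank 0. *)
Lemma genus_one_rank n (G : cgraph n) : genus G = 1%R <-> \rank (crossing_mx G) = 2.
Proof.
rewrite /genus; case: eqVneq => [G0|G0].
  split=> [/eqP//|rk]; have := rank_leq_row (crossing_mx G).
  by rewrite rk G0 cards0.
have z2 := face_count G0; rewrite card_cross_kernel -expnS in z2.
have z : ncycles ((alpha G)^-1 * sigma G)%g = (#|edges G| - \rank (crossing_mx G)).+1.
  by apply/eqP; rewrite -(eqn_exp2l _ _ (isT : 1 < 2)) z2.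
rewrite z ncycles_alpha card_points.
have rk := rank_leq_row (crossing_mx G).
set r := \rank _ in rk *; set m := #|edges G| in rk *.
rewrite -natr1 natrB // natrM; split=> [eq1|->]; last by lra.
by apply/eqP; rewrite -(Num.Theory.eqr_nat rat); apply/eqP; lra.
Qed.

Theorem proposition4 (n : nat) (T T3 : cgraph n)
  (hT : is_tree T) (hred : reduced_form T T3) :
  genus T3 = 1%R <-> genus T = 1%R.
Proof.
have := reduced_rank_two hred.
have := genus_one_rank T3; have := genus_one_rank T.
by have := rank_twoP T3; have := rank_twoP T; tauto.
Qed.
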